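(* Let $a>0$ and $0<t<1$. For every $p\ge 0$, the function $V(x)=\int_0^\infty\log\left|\frac{z_1(x,s)}{z_2(x,s)}\right|ds$ satisfies, for $x>0$, $$V(x)=\frac{x}{t(1-t)}-\frac{\sqrt{p^2t^2+4ax}}{t}-p\log\left(\sqrt{p^2t^2+4ax}-pt\right)+\frac{a(1-t)}{t}+p\log(2a(1-t)),$$ and $\sigma=\int_0^\infty\mu_2^s\,ds$ is the measure on $(-\infty,0]$ with density $$\frac{d\sigma(x)}{dx}=\begin{cases}\dfrac{\sqrt{4a|x|-p^2t^2}}{2\pi t|x|}, & x\in\left(-\infty,-\frac{p^2t^2}{4a}\right],\\[2mm] 0, & x\in\left(-\frac{p^2t^2}{4a},0\right].\end{cases}$$
   Context: For $s>0$ let $$A_s(z)=\frac{(z+st(1-t))\left(z^2+(1-t)(a(1-t)+(s+p)t)z+ast(1-t)^3\right)}{z^2},$$ which for $p=0$ equals $\frac{(z+a(1-t)^2)(z+st(1-t))^2}{z^2}$. For $x\in\mathbb{C}$, let $z_1(x,s),z_2(x,s),z_3(x,s)$ be the three solutions (with multiplicity) of $A_s(z)=x$, labelled so that $|z_1(x,s)|\ge|z_2(x,s)|\ge|z_3(x,s)|>0$. Put $\Gamma_2(s)=\{x\in\mathbb{C}:|z_2(x,s)|=|z_3(x,s)|\}$, which is an interval of the form $(-\infty,\eta(s)]$ with $\eta(s)\le 0$. Let $\mu_2^s$ be the positive measure (of total mass $1/2$) on $\Gamma_2(s)$ given by $$d\mu_2^s(x)=\frac{1}{2\pi i}\left(\frac{z_{2-}'(x,s)}{z_{2-}(x,s)}-\frac{z_{2+}'(x,s)}{z_{2+}(x,s)}\right)dx,$$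 where $'$ is the derivative with respect to $x$, and $z_{2\pm}(x,s)$ is the limiting value of $z_2(\tilde x,s)$ as $\tilde x\to x$ from the upper ($+$) or lower ($-$) half-plane. The measure $\sigma=\int_0^\infty\mu_2^s\,ds$ is defined by $\sigma(E)=\int_0^\infty\mu_2^s(E)\,ds$ for Borel sets $E$. *)

(* Defs.v *)
From HB Require Import structures.
From mathcomp Require Import all_boot all_order all_algebra.
From mathcomp Require Import all_classical all_reals all_analysis.
From mathcomp Require Import complex.

Set Implicit Arguments.
Unset Strict Implicit.
Unset Printing Implicit Defensive.

Import Order.TTheory GRing.Theory Num.Theory.
Import numFieldNormedType.Exports.

Local Open Scope classical_set_scope.
Local Open Scope ring_scope.
Local Open Scope complex_scope.

Section Defs.
Variable R : realType.

(* [`|z|] on [R[i]] is again an element of [R[i]]; this is the same modulus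
   with values in [R]. *)
Definition modulus (z : R[i]) : R := ComplexField.Normc.normc z.

Definition A (a t p s : R) (z : R[i]) : R[i] :=
  (z + (s * t * (1 - t))%:C)
  * (z ^+ 2 + ((1 - t) * (a * (1 - t) + (s + p) * t))%:C * z
     + (a * s * t * (1 - t) ^+ 3)%:C)
  / z ^+ 2.

(* The factorization says that z1, z2, z3 are the zeros of A_s - x on the
   punctured plane, counted with multiplicity. *)
Definition ordered_solutions (a t p s : R) (x z1 z2 z3 : R[i]) : Prop :=
  [/\ forall w : R[i], w != 0 ->
        A a t p s w - x = (w - z1) * (w - z2) * (w - z3) / w ^+ 2,
      modulus z2 <= modulus z1,
      modulus z3 <= modulus z2
    & 0 < modulus z3].

(* The labelling is not unique where two moduli coincide, so z1, z2, z3 are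
   taken to be an arbitrary choice of labelled solutions. *)
Definition labelled_solutions (a t p : R) (z1 z2 z3 : R[i] -> R -> R[i]) :
    Prop :=
  forall (x : R[i]) (s : R), 0 < s ->
    ordered_solutions a t p s x (z1 x s) (z2 x s) (z3 x s).

Definition Gamma2 (z2 z3 : R[i] -> R -> R[i]) (s : R) : set R[i] :=
  [set x | modulus (z2 x s) = modulus (z3 x s)].

(* [R[i]^o] is [R[i]] equipped with the topology of its modulus. *)
Definition upper_limit (f : R[i] -> R[i]) (x : R) : R[i] :=
  lim ((f w : R[i]^o) @[w --> within [set w : R[i]^o | 0 < complex.Im w]
                                     (nbhs (x%:C : R[i]^o))]).

Definition lower_limit (f : R[i] -> R[i]) (x : R) : R[i] :=
  lim ((f w : R[i]^o) @[w --> within [set w : R[i]^o | complex.Im w < 0]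
                                     (nbhs (x%:C : R[i]^o))]).

(* Componentwise, as the library has no normed R-module structure on [R[i]]. *)
Definition cderive (f : R -> R[i]) (x : R) : R[i] :=
  derive1 (fun y => complex.Re (f y)) x
  +i* derive1 (fun y => complex.Im (f y)) x.

Definition mu2_density (z2 : R[i] -> R -> R[i]) (s x : R) : R[i] :=
  let z2p := upper_limit (z2 ^~ s) in
  let z2m := lower_limit (z2 ^~ s) in
  (0 +i* (2 * pi))^-1 * (cderive z2m x / z2m x - cderive z2p x / z2p x).

(* Since A_s has real coefficients, z_{2-} is the complex conjugate of z_{2+}
   on Gamma_2(s): the density is real and [complex.Re] only changes its
   type. *)
Definition mu2 (z2 z3 : R[i] -> R -> R[i]) (s : R) (E : set R) : \bar R :=
  \int[lebesgue_measure]_(x in E `&` [set x : R | Gamma2 z2 z3 s x%:C])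
    (complex.Re (mu2_density z2 s x))%:E.

Definition sigma (z2 z3 : R[i] -> R -> R[i]) (E : set R) : \bar R :=
  \int[lebesgue_measure]_(s in `]0, +oo[) mu2 z2 z3 s E.

Definition V (z1 z2 : R[i] -> R -> R[i]) (x : R) : \bar R :=
  \int[lebesgue_measure]_(s in `]0, +oo[)
    (ln (modulus (z1 x%:C s / z2 x%:C s)))%:E.

Definition sigma_density (a t p x : R) : R :=
  if x <= - (p ^+ 2 * t ^+ 2 / (4 * a))
  then Num.sqrt (4 * a * `|x| - p ^+ 2 * t ^+ 2) / (2 * pi * t * `|x|)
  else 0.

End Defs.

(* Main.v *)
Require Import Defs.
From HB Require Import structures.
From mathcomp Require Import all_boot all_order all_algebra.
From mathcomp Require Import all_classical all_reals all_analysis.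
From mathcomp Require Import measurable_realfun complex ring lra.

Import Order.TTheory GRing.Theory Num.Theory.
Import numFieldNormedType.Exports.

Local Open Scope classical_set_scope.
Local Open Scope ring_scope.
Local Open Scope complex_scope.

(** Put al = a(1-t)^2, q = pt(1-t), b = t(1-t)s.  Clearing denominators,
    A_s(z) = x becomes a cubic in z,
      (z + b)((z + al)(z + b) + q z) = x z^2,
    and for fixed x the curve of its solutions (z, b) is rational: with
    u = 1 + b/z it reads z = x/u^2 - q/u - al, b = (u - 1) z.  Both formulas
    come from integrating over b along this curve.

    For V, write log|z1/z2| as the integral of dv/v over b/|z1| < v < b/|z2|.
    In the coordinate u = 1 + v or u = 1 - v this window is the single
    inequality b < v |z(u)| ([uniformized_window]), so exchanging the two
    integrations leaves the integral of |z(u)| between u = 1 and the positive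
    zero u of z(u), that is of al u^2 + q u = x; its primitive is elementary
    ([integral_window_length]).  The window holds for the moduli because, for
    x > 0, the smallest root is negative and smaller than al and b in absolute
    value, and the other two are conjugate, both positive, or both below -b
    ([positive_window]).

    For sigma, take x = -X < 0.  There is exactly one root below -b; its
    ratio r = zeta/(zeta + b) exceeds 1 and determines everything rationally,
    b being an increasing function of r.  The other two roots form a conjugate
    pair exactly when a discriminant [pair_disc], decreasing in r, is
    positive, and for x < 0 this is, up to one value of x, membership in
    Gamma_2.
    Continuity of roots and a sign argument ([pairing_sign]) identify the
    boundary values of z2: from the upper half-plane z2 tends to the member of
    the pair with negative imaginary part ([branch_limit]).  Hence the density
    of mu_2^s is Im(z'/z)/pi for the other member z of the pair.  Along the
    curve with x fixed, z_x/z = b_u^-1 / u^2 = d(-1/u)/db, so this density is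
    -1/pi times the b-derivative of |Im(1/u)| = sqrt(pair_disc)/X.  Integrating
    over s, the contribution at the end where the pair becomes real vanishes
    and the one at b = 0 (r = 1) gives the stated square root
    ([integral_mu2_rate]).  Tonelli's theorem then gives sigma. *)

(** * Cubics and their symmetric functions *)

Section LinearCombinations.
Variable K : comPzRingType.
Implicit Types a b c l r : K.

(** Certificates for consequences of polynomial equations: it remains to check,
    by [ring], that a - b is the announced combination. *)
Lemma lincomb1 c l r a b : l = r -> a - b = c * (l - r) -> a = b.
Proof. by move=> -> /eqP; rewrite subrr mulr0 subr_eq0 => /eqP. Qed.

Lemma lincomb2 c l r c' l' r' a b : l = r -> l' = r' ->
  a - b = c * (l - r) + c' * (l' - r') -> a = b.
Proof.
by move=> -> -> /eqP; rewrite !subrr !mulr0 addr0 subr_eq0 => /eqP.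
Qed.

Lemma lincomb3 c l r c' l' r' c'' l'' r'' a b :
  l = r -> l' = r' -> l'' = r'' ->
  a - b = c * (l - r) + c' * (l' - r') + c'' * (l'' - r'') -> a = b.
Proof.
by move=> -> -> -> /eqP; rewrite !subrr !mulr0 !addr0 subr_eq0 => /eqP.
Qed.

End LinearCombinations.

Section SymmetricFunctions.
Variable K : numFieldType.
Implicit Types c z u w : K.

Definition cubic_roots c2 c1 c0 z1 z2 z3 : Prop :=
  [/\ z1 + z2 + z3 = - c2, z1 * z2 + z1 * z3 + z2 * z3 = c1
    & z1 * z2 * z3 = - c0].

(** The context only gives the factorization away from zero; three points
    suffice to compare quadratic polynomials. *)
Lemma cubic_roots_of_factorization c2 c1 c0 z1 z2 z3 :
  (forall w, w != 0 -> w ^+ 3 + c2 * w ^+ 2 + c1 * w + c0 =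
                       (w - z1) * (w - z2) * (w - z3)) ->
  cubic_roots c2 c1 c0 z1 z2 z3.
Proof.
move=> h.
have h1 := h 1 (oner_neq0 _).
have /h h2 : - 1 != 0 :> K by rewrite oppr_eq0 oner_eq0.
have two : (2 : K) != 0 by rewrite pnatr_eq0.
have three : (3 : K) != 0 by rewrite pnatr_eq0.
have h3 := h 2 two.
have E1 : z1 * z2 + z1 * z3 + z2 * z3 = c1.
  by apply: (mulfI two); apply: (lincomb2 _ (-1) _ _ 1 _ _ _ _ h1 h2); ring.
have E2 : z1 + z2 + z3 = - c2.
  apply: (mulfI three); apply: (lincomb3 _ 1 _ _ (-1) _ _ 1 _ _ _ _ h3 h1 E1).
  ring.
by split=> //; apply: (lincomb3 _ 1 _ _ 1 _ _ (-1) _ _ _ _ h1 E1 E2); ring.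
Qed.

Lemma cubic_rootsE c2 c1 c0 z1 z2 z3 : cubic_roots c2 c1 c0 z1 z2 z3 ->
  forall w, w ^+ 3 + c2 * w ^+ 2 + c1 * w + c0 =
            (w - z1) * (w - z2) * (w - z3).
Proof.
move=> [E2 E1 E0] w.
apply: (lincomb3 _ (w ^+ 2) _ _ (- w) _ _ 1 _ _ _ _ E2 E1 E0); ring.
Qed.

Lemma cubic_roots_perm c2 c1 c0 z1 z2 z3 u1 u2 u3 :
  cubic_roots c2 c1 c0 z1 z2 z3 -> cubic_roots c2 c1 c0 u1 u2 u3 ->
  [\/ [/\ z1 = u1, z2 = u2 & z3 = u3], [/\ z1 = u1, z2 = u3 & z3 = u2]
    | [\/ [/\ z1 = u2, z2 = u1 & z3 = u3], [/\ z1 = u3, z2 = u1 & z3 = u2],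
          [/\ z1 = u2, z2 = u3 & z3 = u1] | [/\ z1 = u3, z2 = u2 & z3 = u1]]].
Proof.
have two_of_two a b c d : a + b = c + d -> a * b = c * d :> K ->
    (a = c /\ b = d) \/ (a = d /\ b = c).
  move=> S P; have /eqP : (a - c) * (a - d) = 0.
    by apply: (lincomb2 _ a _ _ (-1) _ _ _ _ S P); ring.
  rewrite mulf_eq0 !subr_eq0 => /orP[]/eqP ac; [left|right]; split=> //.
    by apply: (addrI a); rewrite S ac.
  by apply: (addrI a); rewrite S ac addrC.
move=> Z U; have zu w : (w - z1) * (w - z2) * (w - z3) =
    (w - u1) * (w - u2) * (w - u3).
  by rewrite -(cubic_rootsE _ _ _ _ _ _ Z) -(cubic_rootsE _ _ _ _ _ _ U).
move: Z U => [S Q _] [S' Q' _].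
have /eqP := zu u1; rewrite subrr !mul0r !mulf_eq0 !subr_eq0 -orbA.
move=> /or3P[]/eqP e; rewrite -{}e in S Q zu *.
- have : z2 + z3 = u2 + u3 by apply: (addrI u1); rewrite !addrA S S'.
  move=> SS; have PP : z2 * z3 = u2 * u3.
    by apply: (lincomb3 _ 1 _ _ (-1) _ _ (- u1) _ _ _ _ Q Q' SS); ring.
  by have [[-> ->]|[-> ->]] := two_of_two _ _ _ _ SS PP; [apply: Or31|apply: Or32].
- have SS : z1 + z3 = u2 + u3.
    by apply: (lincomb2 _ 1 _ _ (-1) _ _ _ _ S S'); ring.
  have PP : z1 * z3 = u2 * u3.
    by apply: (lincomb3 _ 1 _ _ (-1) _ _ (- u1) _ _ _ _ Q Q' SS); ring.
  by apply: Or33; have [[-> ->]|[-> ->]] := two_of_two _ _ _ _ SS PP;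
    [apply: Or41|apply: Or42].
- have SS : z1 + z2 = u2 + u3.
    by apply: (lincomb2 _ 1 _ _ (-1) _ _ _ _ S S'); ring.
  have PP : z1 * z2 = u2 * u3.
    by apply: (lincomb3 _ 1 _ _ (-1) _ _ (- u1) _ _ _ _ Q Q' SS); ring.
  by apply: Or33; have [[-> ->]|[-> ->]] := two_of_two _ _ _ _ SS PP;
    [apply: Or43|apply: Or44].
Qed.

End SymmetricFunctions.

(** * Moduli of labelled solutions *)

Section Moduli.
Variable R : realType.
Implicit Types (x y : R) (z : R[i]).

Lemma modulus_real x : modulus x%:C = `|x|.
Proof. by rewrite /modulus /= expr0n /= addr0 sqrtr_sqr. Qed.

Lemma modulus_pair x y : modulus (x +i* y) = Num.sqrt (x ^+ 2 + y ^+ 2).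
Proof. by []. Qed.

Lemma modulus_ge0 z : 0 <= modulus z.
Proof. by case: z => x y; rewrite modulus_pair sqrtr_ge0. Qed.

Lemma sqr_modulus x y : modulus (x +i* y) ^+ 2 = x ^+ 2 + y ^+ 2.
Proof. by rewrite modulus_pair sqr_sqrtr// addr_ge0// sqr_ge0. Qed.

Lemma modulus_norm z : (modulus z)%:C = `|z|.
Proof. by case: z. Qed.

Lemma modulusM z1 z2 : modulus (z1 * z2) = modulus z1 * modulus z2.
Proof. exact: ComplexField.Normc.normcM. Qed.

Lemma modulusV z : modulus z^-1 = (modulus z)^-1.
Proof. exact: ComplexField.Normc.normcV. Qed.

(** The labelling is ambiguous where moduli coincide, but the moduli themselves
    are not: any explicitly known sorted list of the roots computes them. *)
Lemma sorted_moduli c2 c1 c0 z1 z2 z3 u1 u2 u3 :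
  cubic_roots (R[i]) c2 c1 c0 z1 z2 z3 -> cubic_roots (R[i]) c2 c1 c0 u1 u2 u3 ->
  modulus z2 <= modulus z1 -> modulus z3 <= modulus z2 ->
  modulus u2 <= modulus u1 -> modulus u3 <= modulus u2 ->
  [/\ modulus z1 = modulus u1, modulus z2 = modulus u2
    & modulus z3 = modulus u3].
Proof.
move=> Z U z21 z32 u21 u32.
by case: (cubic_roots_perm _ _ _ _ _ _ _ _ _ _ Z U) =>
  [[e1 e2 e3]|[e1 e2 e3]|[][e1 e2 e3]]; rewrite e1 e2 e3 in z21 z32 *;
  split; apply/eqP; rewrite eq_le; apply/andP; split=> //; lra.
Qed.

End Moduli.

Section Equation.
Variable R : realType.
Implicit Types (al b q : R) (x z : R[i]).

Definition sorted_roots al b q x z1 z2 z3 : Prop :=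
  [/\ cubic_roots (R[i]) ((al + 2 * b + q)%:C - x) (b * (2 * al + b + q))%:C
        (al * b ^+ 2)%:C z1 z2 z3,
      modulus z2 <= modulus z1 & modulus z3 <= modulus z2].

Lemma ordered_solutions_sorted_roots (a t p s : R) x z1 z2 z3 :
  ordered_solutions a t p s x z1 z2 z3 ->
  sorted_roots (a * (1 - t) ^+ 2) (t * (1 - t) * s) (p * t * (1 - t)) x z1 z2 z3.
Proof.
move=> [h le21 le32 _]; split=> //; apply: cubic_roots_of_factorization.
move=> w w0; have := h w w0; rewrite /A => /(congr1 ( *%R ^~ (w ^+ 2))).
rewrite divfK ?expf_neq0// => <-.
rewrite !(rmorphM, rmorphD, rmorphB, rmorphXn, rmorph1, rmorph_nat)/=.
by field.
Qed.

End Equation.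

(** * Roots for positive x *)

Section PositiveX.
Variables (R : realType) (al b q x : R).
Hypotheses (al0 : 0 < al) (b0 : 0 < b) (q0 : 0 <= q) (x0 : 0 < x).

Let f (y : R) := y ^+ 3 + (al + 2 * b + q - x) * y ^+ 2
  + b * (2 * al + b + q) * y + al * b ^+ 2.

Lemma between_factors (u1 u2 y : R) : u2 <= u1 ->
  ((y - u1) * (y - u2) < 0) = (u2 < y < u1).
Proof.
move=> u21; apply/idP/idP => [h|/andP[h1 h2]]; last by nra.
by rewrite !ltNge; apply/andP; split; apply/negP => h'; nra.
Qed.

(** At - min(al, b) the cubic equals -x z^2 or less, since one of the factors
    z + b, z + al vanishes there; at 0 it is positive. *)
Lemma small_negative_root : exists rho, [/\ - al < rho, - b < rho, rho < 0 & f rho = 0].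
Proof.
pose P : {poly R} := 'X ^+ 3 + (al + 2 * b + q - x) *: 'X ^+ 2
  + (b * (2 * al + b + q)) *: 'X + (al * b ^+ 2)%:P.
have PE y : P.[y] = f y by rewrite /P /f !(hornerE, hornerXn)/=; ring.
pose m := Num.min al b.
have m0 : 0 < m by rewrite lt_min al0.
have fm : f (- m) < 0.
  rewrite /m; case: (leP al b) => ab.
    have -> : f (- al) = - (q * al * (b - al)) - x * al ^+ 2 by rewrite /f; ring.
    have : 0 <= q * al * (b - al) by rewrite !mulr_ge0// ?subr_ge0// ltW.
    have : 0 < x * al ^+ 2 by rewrite mulr_gt0// exprn_gt0.
    lra.
  have -> : f (- b) = - (x * b ^+ 2) by rewrite /f; ring.
  by rewrite oppr_lt0 mulr_gt0// exprn_gt0.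
have f0 : 0 < f 0.
  have -> : f 0 = al * b ^+ 2 by rewrite /f; ring.
  by rewrite mulr_gt0// exprn_gt0.
have [||rho] := @poly_ivt R P (- m) 0.
- by lra.
- by rewrite !PE ltW//= ltW.
move=> /andP[r1 r2] /rootP; rewrite PE => fr; exists rho.
have {}r1 : - m < rho.
  by rewrite lt_neqAle r1 andbT; apply/eqP => e; rewrite -e in fr; lra.
have {}r2 : rho < 0.
  by rewrite lt_neqAle r2 andbT; apply/eqP => e; rewrite e in fr; lra.
have : m <= al by rewrite ge_min lexx.
have : m <= b by rewrite ge_min lexx orbT.
by split=> //; lra.
Qed.

(** The two remaining roots have the same sign.  If both are positive, f < 0
    on the positive axis exactly between them.  If both are negative, they lie
    below -b: f(-b) < 0 puts them on the same side of -b, and otherwise their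
    product with rho, |rho| < al, would be too small. *)
Lemma real_roots_window (u1 u2 rho : R) :
  - al < rho -> - b < rho -> rho < 0 -> `|u2| <= `|u1| ->
  u1 + u2 + rho = - (al + 2 * b + q - x) ->
  u1 * u2 + u1 * rho + u2 * rho = b * (2 * al + b + q) ->
  u1 * u2 * rho = - (al * b ^+ 2) ->
  `|rho| < `|u2| /\
  forall y : R, 0 < y ->
   (`|u2| < y < `|u1|) = (f y < 0) || (b < y) && (0 < f (- y)).
Proof.
move=> rho1 rho2 rho0 u21 S Q P.
have fE y : f y = (y - rho) * ((y - u1) * (y - u2)).
  rewrite /f.
  by apply: (lincomb3 _ (y ^+ 2) _ _ (- y) _ _ 1 _ _ _ _ S Q P); ring.
have c0 : 0 < al * b ^+ 2 by rewrite mulr_gt0// exprn_gt0.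
have uu : 0 < u1 * u2 by nra.
have [u2p|u2n|u2e] := ltrgtP u2 0; last by rewrite u2e mulr0 ltxx in uu.
  have u1n : u1 < 0 by nra.
  rewrite (ltr0_norm u2p) (ltr0_norm u1n) (ltr0_norm rho0).
  rewrite (ltr0_norm u2p) (ltr0_norm u1n) in u21.
  have fb : f (- b) = - (x * b ^+ 2) by rewrite /f; ring.
  have xb : 0 < x * b ^+ 2 by rewrite mulr_gt0// exprn_gt0.
  have bb : 0 < (- b - u1) * (- b - u2).
    rewrite ltNge; apply/negP => h; have : 0 <= f (- b).
      by rewrite fE mulr_le0//; lra.
    by lra.
  have bu2 : b < - u2.
    rewrite ltNge; apply/negP => h.
    have bu1 : - u1 < b by nra.
    have : (- u1) * (- u2) <= b ^+ 2 by rewrite expr2 ler_pM//; lra.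
    rewrite mulrNN => h2.
    have : al * b ^+ 2 <= (- rho) * b ^+ 2.
      have -> : al * b ^+ 2 = (- rho) * (u1 * u2) by lra.
      by rewrite ler_wpM2l//; lra.
    by rewrite ler_pM2r ?exprn_gt0//; lra.
  split; first by lra.
  move=> y y0.
  have -> : (f y < 0) = false.
    by apply/negbTE; rewrite -leNgt fE !mulr_ge0//; lra.
  rewrite /=; have [yb|yb] := ltP b y; last first.
    by apply/negbTE/negP => /andP[]; lra.
  rewrite -(between_factors (- u1) (- u2) y) /=; last by lra.
  rewrite fE -oppr_lt0.
  have -> : - ((- y - rho) * ((- y - u1) * (- y - u2))) =
     (y + rho) * ((y - - u1) * (y - - u2)) by ring.
  by rewrite [RHS]pmulr_rlt0//; lra.
have u1p : 0 < u1 by nra.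
rewrite (gtr0_norm u2n) (gtr0_norm u1p) (ltr0_norm rho0).
rewrite (gtr0_norm u2n) (gtr0_norm u1p) in u21.
split.
  have : f (- u2) < f u2.
    rewrite -subr_lt0.
    have -> : f (- u2) - f u2 = - (2 * (u2 ^+ 3 + b * (2 * al + b + q) * u2)).
      by rewrite /f; ring.
    rewrite oppr_lt0 mulr_gt0// addr_gt0 ?exprn_gt0// !mulr_gt0//.
    by rewrite ltr_wpDr// addr_gt0// mulr_gt0.
  rewrite !fE subrr !mulr0 => h.
  have h1 : 0 < (- u2 - u1) * (- u2 - u2) by rewrite -mulrNN mulr_gt0//; lra.
  by move: h; rewrite pmulr_llt0//; lra.
move=> y y0.
have -> : (b < y) && (0 < f (- y)) = false.
  apply/negbTE/negP => /andP[yb]; rewrite fE => h.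
  have h1 : 0 < (- y - u1) * (- y - u2) by rewrite -mulrNN mulr_gt0//; lra.
  by move: h; rewrite pmulr_lgt0//; lra.
rewrite orbF fE pmulr_rlt0; last by lra.
by rewrite between_factors.
Qed.

Lemma conjugate_roots_window (xi eta rho : R) :
  - al < rho -> - b < rho -> rho < 0 ->
  2 * xi + rho = - (al + 2 * b + q - x) ->
  xi ^+ 2 + eta ^+ 2 + 2 * xi * rho = b * (2 * al + b + q) ->
  (xi ^+ 2 + eta ^+ 2) * rho = - (al * b ^+ 2) ->
  rho ^+ 2 < xi ^+ 2 + eta ^+ 2 /\
  forall y : R, 0 < y -> (f y < 0) || (b < y) && (0 < f (- y)) = false.
Proof.
move=> rho1 rho2 rho0 S Q P.
have fE y : f y = (y - rho) * ((y - xi) ^+ 2 + eta ^+ 2).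
  rewrite /f.
  by apply: (lincomb3 _ (y ^+ 2) _ _ (- y) _ _ 1 _ _ _ _ S Q P); ring.
have pos y : 0 <= (y - xi) ^+ 2 + eta ^+ 2 by rewrite addr_ge0// sqr_ge0.
split.
  have h1 : (- rho) ^+ 2 < b ^+ 2 by rewrite ltr_pXn2r// ?nnegrE; lra.
  have h2 : (- rho) * (- rho) ^+ 2 < al * b ^+ 2.
    by apply: ltr_pM => //; rewrite ?sqr_ge0//; lra.
  have : (- rho) * (- rho) ^+ 2 < (- rho) * (xi ^+ 2 + eta ^+ 2) by lra.
  by rewrite ltr_pM2l ?sqrrN//; lra.
move=> y y0; apply/negbTE; rewrite negb_or -!leNgt; apply/andP; split.
  by rewrite fE mulr_ge0//; lra.
apply/negP => /andP[yb]; apply/negP; rewrite -leNgt fE mulr_le0_ge0//.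
by lra.
Qed.

(** The set of y between |z2| and |z1| in terms of the signs of the cubic alone,
    which holds uniformly in the three possible configurations of the roots. *)
Lemma positive_window (z1 z2 z3 : R[i]) : sorted_roots R al b q x%:C z1 z2 z3 ->
  [/\ 0 < modulus z3, modulus z3 < modulus z2 & forall y : R, 0 < y ->
    (modulus z2 < y < modulus z1) = (f y < 0) || (b < y) && (0 < f (- y))].
Proof.
move=> [Z z21 z32].
have [rho [rho1 rho2 rho0 frho]] := small_negative_root.
pose xi := - ((al + 2 * b + q - x) + rho) / 2.
pose C := b * (2 * al + b + q) - 2 * xi * rho.
have CE : C * rho = - (al * b ^+ 2).
  by move: frho; rewrite /f /C /xi; nra.
have xiE : 2 * xi + rho = - (al + 2 * b + q - x) by rewrite /xi; field.
have mrho : modulus rho%:C = `|rho| by rewrite modulus_real.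
have [disc|disc] := leP (xi ^+ 2) C; last first.
  pose d := Num.sqrt (xi ^+ 2 - C).
  have d2 : d ^+ 2 = xi ^+ 2 - C by rewrite sqr_sqrtr//; lra.
  have d0 : 0 <= d by rewrite sqrtr_ge0.
  pose sg : R := if 0 <= xi then 1 else -1.
  have sg2 : sg ^+ 2 = 1 by rewrite /sg; case: ifP => _; ring.
  pose u1 := xi + sg * d; pose u2 := xi - sg * d.
  have P : u1 * u2 = C.
    have -> : u1 * u2 = xi ^+ 2 - sg ^+ 2 * d ^+ 2 by rewrite /u1 /u2; ring.
    by rewrite sg2 mul1r d2; ring.
  have S : u1 + u2 = 2 * xi by rewrite /u1 /u2; ring.
  have u21 : `|u2| <= `|u1|.
    rewrite -ler_sqr ?nnegrE// !real_normK ?num_real//.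
    rewrite -subr_ge0; have -> : u1 ^+ 2 - u2 ^+ 2 = 4 * (xi * sg) * d.
      by rewrite /u1 /u2; ring.
    rewrite mulr_ge0// mulr_ge0//= /sg; case: ifPn; lra.
  have [|||h1 h2] := real_roots_window u1 u2 rho rho1 rho2 rho0 u21.
  - by rewrite S.
  - by rewrite P -addrA -mulrDl S /C; ring.
  - by rewrite P.
  have U : cubic_roots (R[i]) ((al + 2 * b + q)%:C - x%:C)
      (b * (2 * al + b + q))%:C (al * b ^+ 2)%:C u1%:C u2%:C rho%:C.
    split; rewrite -?(rmorphD, rmorphB, rmorphN, rmorphM); congr (_%:C).
    - by rewrite S.
    - by rewrite P -addrA -mulrDl S /C; ring.
    - by rewrite P.
  have [||-> -> ->] := sorted_moduli _ _ _ _ _ _ _ _ _ _ Z U z21 z32;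
    rewrite !modulus_real//; first exact: ltW.
  by split=> //; rewrite normr_gt0; lra.
pose d := Num.sqrt (C - xi ^+ 2).
have d2 : d ^+ 2 = C - xi ^+ 2 by rewrite sqr_sqrtr//; lra.
have Cd : xi ^+ 2 + d ^+ 2 = C by rewrite d2; ring.
have [|||h1 h2] := conjugate_roots_window xi d rho rho1 rho2 rho0.
- by [].
- by rewrite Cd /C; ring.
- by rewrite Cd.
have U : cubic_roots (R[i]) ((al + 2 * b + q)%:C - x%:C)
    (b * (2 * al + b + q))%:C (al * b ^+ 2)%:C (xi +i* d) (xi -i* d) rho%:C.
  split; apply/eqP; rewrite eq_complex /=; apply/andP; split; apply/eqP.
  - by lra.
  - by ring.
  - by move: Cd; rewrite /C; lra.
  - by ring.
  - by rewrite -CE -Cd; ring.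
  - by ring.
have rm : modulus rho%:C < modulus (xi +i* d).
  rewrite modulus_real modulus_pair -sqrtr_sqr ltr_sqrt//.
  by rewrite (le_lt_trans _ h1)// sqr_ge0.
have mm : modulus (xi -i* d) = modulus (xi +i* d).
  by rewrite !modulus_pair sqrrN.
have [||-> -> ->] := sorted_moduli _ _ _ _ _ _ _ _ _ _ Z U z21 z32.
- by rewrite mm.
- by rewrite mm ltW.
split; rewrite ?mm//.
- by rewrite modulus_real normr_gt0; lra.
- move=> y y0; rewrite h2//; apply/negbTE/negP => /andP[]; lra.
Qed.

End PositiveX.

(** * Tools of integration *)

Section FTC.
Variable R : realType.
Local Notation mu := (@lebesgue_measure R).

Lemma continuous_of_is_derive (f : R -> R) (x d : R) :
  is_derive x 1 f d -> {for x, continuous f}.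
Proof.
by case=> dx _; apply: differentiable_continuous; exact/derivable1_diffP.
Qed.

Lemma is_derive_inv (x : R) : x != 0 ->
  is_derive x 1 (fun v : R => v^-1) (- x ^- 2).
Proof.
move=> x0; have := @is_deriveV R id x 1 1 x0 (is_derive_id x 1).
by move/is_derive_eq; apply; rewrite /GRing.scale/= mulr1.
Qed.

(** The derivative may blow up at the endpoints, as it does for the square root
    of a discriminant: nonnegativity allows monotone convergence along an
    exhaustion by compact intervals. *)
Lemma ge0_FTC2_oo (f F : R -> R) (a b la lb : R) : a < b ->
  (forall x, a < x < b -> 0 <= f x) ->
  (forall x, a < x < b -> {for x, continuous f}) ->
  (forall x, a < x < b -> is_derive x 1 F (f x)) ->
  F x @[x --> a^'+] --> la -> F x @[x --> b^'-] --> lb ->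
  (\int[mu]_(x in `]a, b[) (f x)%:E = (lb - la)%:E)%E.
Proof.
move=> ab f0 cf dF Fa Fb.
pose e n : R := (b - a) / n.+3%:R.
have ba : 0 < b - a by rewrite subr_gt0.
have e0 n : 0 < e n by rewrite divr_gt0.
have e_lt n : e n < (b - a) / 2.
  by rewrite ltr_pM2l// ltf_pV2 ?posrE// ltr_nat.
have e_le m n : (m <= n)%N -> e n <= e m.
  by move=> mn; rewrite ler_pM2l// lef_pV2 ?posrE// ler_nat !ltnS.
have e_cvg : e @ \oo --> (0 : R).
  have -> : (0 : R) = (b - a) * 0 by rewrite mulr0.
  apply: cvgMr.
  have := @cvg_harmonic R; rewrite -(cvg_shiftn 2) /=.
  by under eq_cvg do rewrite /harmonic addn2.
pose I n : set R := `[a + e n, b - e n]%classic.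
have IE : \bigcup_n I n = `]a, b[%classic.
  apply/seteqP; split => x /=.
    move=> [n _]; rewrite /I /= !in_itv/= => /andP[h1 h2].
    by have en := e0 n; apply/andP; split; lra.
  rewrite in_itv/= => /andP[ax xb].
  have m0 : 0 < Num.min (x - a) (b - x) by rewrite lt_min !subr_gt0 ax.
  have [n _ hn] : \forall n \near \oo, e n < Num.min (x - a) (b - x).
    by move/cvgr_lt : e_cvg; apply.
  exists n => //; rewrite /I /= in_itv/=; have := hn n (leqnn n).
  by rewrite lt_min => /andP[h1 h2]; apply/andP; split; lra.
have In n x : x \in `[a + e n, b - e n] -> a < x < b.
  by rewrite in_itv/= => /andP[h1 h2]; have en := e0 n; apply/andP; split; lra.
have cfI n : {within I n, continuous f}.
  apply: continuous_in_subspaceT => x; rewrite inE => /In; exact: cf.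
have key : ((\int[mu]_(x in I n) (f x)%:E)%E @[n --> \oo] -->
    (\int[mu]_(x in \bigcup_n I n) (f x)%:E)%E).
  apply: ge0_nondecreasing_set_cvg_integral => //.
  - move=> m n mn; rewrite subsetEset => x; rewrite /I /= !in_itv/=.
    by move=> /andP[h1 h2]; have emn := e_le _ _ mn; apply/andP; split; lra.
  - by move=> i; exact: measurable_itv.
  - move=> n; apply/measurable_realfun.measurable_EFinP.
    by apply: subspace_continuous_measurable_fun;
      [exact: measurable_itv|exact: cfI].
  - by move=> n x /In/f0; rewrite /= lee_fin.
rewrite IE in key; apply: (cvg_unique _ key) => //.
have -> : (fun n => \int[mu]_(x in I n) (EFin \o f) x)%E =
    (fun n => (F (b - e n) - F (a + e n))%:E).
  apply/funext => n; rewrite EFinB; apply: continuous_FTC2 => //.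
  - by have eln := e_lt n; lra.
  - exact: cfI.
  - have dFc x : a < x < b -> {for x, continuous F}.
      by move=> /dF; exact: continuous_of_is_derive.
    split => /=.
    + move=> x; rewrite in_itv/= => /andP[h1 h2].
      have : a < x < b by have en := e0 n; apply/andP; split; lra.
      by move=> /dF [].
    + apply: cvg_at_right_filter; apply: dFc.
      by have en := e0 n; have eln := e_lt n; apply/andP; split; lra.
    + apply: cvg_at_left_filter; apply: dFc.
      by have en := e0 n; have eln := e_lt n; apply/andP; split; lra.
  - move=> x; rewrite in_itv/= => /andP[h1 h2]; rewrite derive1E.
    apply: derive_val; apply: dF.
    by have en := e0 n; apply/andP; split; lra.
apply: cvg_EFin; first exact: nearW.
apply: cvgB.
  move/cvg_at_leftP : Fb; apply; split => [n|]; first by rewrite ltrBlDr ltrDl.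
  by rewrite -[X in _ --> X]subr0; apply: cvgB => //; exact: cvg_cst.
move/cvg_at_rightP : Fa; apply; split => [n|]; first by rewrite ltrDl.
by rewrite -[X in _ --> X]addr0; apply: cvgD => //; exact: cvg_cst.
Qed.

End FTC.

Section IntegralTools.
Variable R : realType.
Local Notation mu := (@lebesgue_measure R).

Lemma integral_supported (D : set R) (f g : R -> R) :
  (forall x, D x -> g x = f x) -> (forall x, ~ D x -> g x = 0) ->
  (\int[mu]_x (g x)%:E = \int[mu]_(x in D) (f x)%:E)%E.
Proof.
move=> gf g0; rewrite [RHS]integral_mkcond; apply: eq_integral => x _.
rewrite patchE; case: ifPn => [|]; first by rewrite inE => /gf ->.
by move=> /negP; rewrite inE => /g0 ->.
Qed.

Lemma measurable_invr : measurable_fun [set: R] (@GRing.inv R).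
Proof.
have -> : @GRing.inv R = fun x => if x == 0 then 0 else x^-1.
  by apply/funext => x; case: eqP => // ->; rewrite invr0.
apply: measurable_fun_if => //.
- exact: measurable_fun_eqr.
- have -> : [set: R] `&` (fun x : R => x == 0) @^-1` [set false] = [set x | x != 0].
    by apply/seteqP; split => x /=; [move=> [_ /negbT]|move=> /negbTE].
  apply: open_continuous_measurable_fun.
    have -> : [set x : R | x != 0] = ~` [set 0].
      by apply/seteqP; split => x /eqP.
    by apply: closed_openC; exact: closed_eq.
  by move=> x; rewrite inE /= => x0; exact: inv_continuous.
Qed.

Lemma measurable_sqrtr : measurable_fun [set: R] (@Num.sqrt R).
Proof. by apply: continuous_measurable_fun => x; exact: sqrt_continuous. Qed.

Lemma integral_invr_itv (c d : R) : 0 < c -> c <= d ->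
  (\int[mu]_(v in `]c, d[) (v^-1)%:E = (ln (d / c))%:E)%E.
Proof.
move=> c0; rewrite le_eqVlt => /predU1P[<-|cd].
  by rewrite set_itvoo0 integral_set0 divff ?gt_eqF// ln1.
have d0 : 0 < d by exact: lt_trans cd.
rewrite ln_div ?posrE//; apply: (ge0_FTC2_oo R _ (@ln R)) => //.
- by move=> x /andP[cx _]; rewrite invr_ge0 ltW// (lt_trans c0).
- move=> x /andP[cx _]; apply: inv_continuous.
  by rewrite gt_eqF// (lt_trans c0).
- by move=> x /andP[cx _]; apply: is_derive1_ln; rewrite (lt_trans c0).
- by apply: cvg_at_right_filter; exact: continuous_ln.
- by apply: cvg_at_left_filter; exact: continuous_ln.
Qed.

End IntegralTools.

(** * The integral of the logarithmic ratio *)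

Section LogRatio.
Variable R : realType.
Local Notation mu := (@lebesgue_measure R).
Variables (al q x : R).
Hypotheses (al0 : 0 < al) (q0 : 0 <= q) (x0 : 0 < x).

Let g (u : R) := x / u ^+ 2 - q / u - al.
Let Psi (u : R) := - (x / u) - q * ln u - al * u.
Let wl (v : R) : R := Num.max (g (1 + v)) (if v < 1 then - g (1 - v) else 0).

(** With y = b/v, f(y) = y^2 (1+v)^2 (y - g(1+v)) and
    f(-y) = - y^2 (1-v)^2 (y + g(1-v)): the substitution u = 1 + b/z makes the
    equation linear in z. *)
Lemma uniformized_window (b v : R) (z1 z2 z3 : R[i]) :
  0 < b -> 0 < v -> sorted_roots R al b q x%:C z1 z2 z3 ->
  (b / modulus z1 < v < b / modulus z2) = (b < v * wl v).
Proof.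
move=> b0 v0 sol.
have [m30 m32 window] := positive_window R al b q x al0 b0 q0 x0 _ _ _ sol.
have m20 : 0 < modulus z2 by exact: lt_trans m32.
have m10 : 0 < modulus z1 by case: sol => _ h _; exact: lt_le_trans h.
pose y := b / v.
have y0 : 0 < y by rewrite divr_gt0.
have bE : b = v * y by rewrite /y mulrC divfK// gt_eqF.
rewrite ltr_pdivrMr// ltr_pdivlMr// bE !ltr_pM2l//.
rewrite andbC window// lt_max; congr (_ || _).
  rewrite bE.
  set e := (X in X < 0).
  have -> : e = y ^+ 2 * (1 + v) ^+ 2 * (y - g (1 + v)).
    by rewrite /e /g; field; lra.
  rewrite pmulr_rlt0 ?subr_lt0// mulr_gt0// exprn_gt0//; lra.
rewrite bE gtr_pMl//; case: ltP => [v1|_] /=; last by rewrite ltNge ltW.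
set e := (X in 0 < X).
have -> : e = y ^+ 2 * (1 - v) ^+ 2 * (- g (1 - v) - y).
  by rewrite /e /g; field; lra.
rewrite pmulr_rgt0 ?subr_gt0// mulr_gt0// exprn_gt0//; lra.
Qed.

Lemma measurable_wl : measurable_fun [set: R] wl.
Proof.
have mg : measurable_fun [set: R] g.
  apply: measurable_funB => //; apply: measurable_funB.
    apply: measurable_funM => //.
    apply: (measurableT_comp (measurable_invr R)); exact: measurable_funX.
  by apply: measurable_funM => //; exact: measurable_invr.
apply: measurable_maxr.
  by apply: (measurableT_comp mg); exact: measurable_funD.
apply: measurable_fun_ifT => //; first exact: measurable_fun_ltr.
apply: measurableT_comp => //; apply: (measurableT_comp mg).
exact: measurable_funB.
Qed.

Let up : R := (Num.sqrt (q ^+ 2 + 4 * al * x) - q) / (2 * al).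

Lemma up_gt0 : 0 < up.
Proof.
rewrite divr_gt0 ?mulr_gt0// subr_gt0 -[ltLHS]ger0_norm// -sqrtr_sqr.
by rewrite ltr_sqrt ?ltrDl ?mulr_gt0// ltr_wpDl ?sqr_ge0// !mulr_gt0.
Qed.

Lemma up_root : al * up ^+ 2 + q * up = x.
Proof.
have S : Num.sqrt (q ^+ 2 + 4 * al * x) ^+ 2 = q ^+ 2 + 4 * al * x.
  by rewrite sqr_sqrtr// addr_ge0 ?sqr_ge0// !mulr_ge0// ltW.
have an : al != 0 by rewrite gt_eqF.
rewrite /up.
have -> : forall w, al * ((w - q) / (2 * al)) ^+ 2 + q * ((w - q) / (2 * al))
   = (w ^+ 2 - q ^+ 2) / (4 * al) by move=> w; field.
by rewrite S; field.
Qed.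

(** [up] is the only positive zero of g. *)
Lemma gE (u : R) : 0 < u ->
  g u = (up - u) * (al * (u + up) + q) / u ^+ 2.
Proof. by move=> u0; rewrite /g -up_root; field; rewrite gt_eqF. Qed.

Lemma g_gt0 (u : R) : 0 < u < up -> 0 < g u.
Proof.
move=> /andP[u0 uu]; rewrite gE// divr_gt0 ?exprn_gt0// mulr_gt0 ?subr_gt0//.
by rewrite ltr_wpDr// mulr_gt0//; have := up_gt0; lra.
Qed.

Lemma g_le0 (u : R) : up <= u -> g u <= 0.
Proof.
move=> uu; have u0 : 0 < u by have := up_gt0; lra.
rewrite gE// mulr_le0_ge0 ?invr_ge0 ?sqr_ge0//.
rewrite mulr_le0_ge0// ?subr_le0// addr_ge0// mulr_ge0//; first exact: ltW.
by have := up_gt0; lra.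
Qed.

Lemma is_derive_Psi (u : R) : 0 < u -> is_derive u 1 Psi (g u).
Proof.
move=> u0; have un : u != 0 by rewrite gt_eqF.
have dln := is_derive1_ln u0.
have dV := is_derive_inv R u un.
rewrite /Psi; apply: is_derive_eq.
by rewrite /g /GRing.scale /=; field.
Qed.


Lemma continuous_Psi (u : R) : 0 < u -> {for u, continuous Psi}.
Proof.
by move=> u0; exact: (continuous_of_is_derive _ _ _ _ (is_derive_Psi _ u0)).
Qed.

Lemma continuous_g (u : R) : 0 < u -> {for u, continuous g}.
Proof.
move=> u0; have un : u != 0 by rewrite gt_eqF.
have ci : {for u, continuous (fun v : R => v^-1)} by exact: inv_continuous.
apply: cvgB; last exact: cvg_cst.
apply: cvgB; apply: cvgM => //; try exact: cvg_cst.
by apply: cvgV; [rewrite expf_neq0|exact: exprn_continuous].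
Qed.

Variable tau : R.
Hypothesis tau0 : 0 < tau.

(** The two cases up > 1 and up < 1 are one computation with a sign w = 1 or
    w = -1: the coordinate is u = 1 + w v and the integral runs from u = 1 to
    u = up. *)
Lemma integral_window_length :
  (\int[mu]_v (if 0 < v then Num.max 0 (wl v) / tau else 0)%:E
   = ((Psi up - Psi 1) / tau)%:E)%E.
Proof.
have u0 := up_gt0.
have cD (w u : R) : {for u, continuous (fun v : R => 1 + w * v)}.
  by apply: cvgD; [exact: cvg_cst|apply: cvgM => //; exact: cvg_cst].
have main (w e : R) : w ^+ 2 = 1 -> 0 < e -> up = 1 + w * e ->
    (forall v : R, 0 < v < e -> 0 < 1 + w * v) ->
    (forall v : R, 0 < v < e -> 0 <= w * g (1 + w * v)) ->
    (\int[mu]_(v in `]0%R, e[) (w * g (1 + w * v) / tau)%:E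
     = ((Psi up - Psi 1) / tau)%:E)%E.
  move=> w2 e0 upE pos gpos; rewrite mulrBl.
  apply: (ge0_FTC2_oo R (fun v => w * g (1 + w * v) / tau)
    (fun v => Psi (1 + w * v) / tau) 0 e _ _ e0).
  - by move=> v ve; rewrite divr_ge0 ?gpos// ltW.
  - move=> v ve; apply: cvgM; last exact: cvg_cst.
    apply: cvgM; first exact: cvg_cst.
    by apply: (continuous_comp (cD w v)); apply: continuous_g; exact: pos.
  - move=> v ve.
    have d1 : is_derive v 1 (fun v : R => 1 + w * v) w.
      apply: is_derive_eq; rewrite /GRing.scale/=. ring.
    have d2 := is_derive_Psi _ (pos v ve).
    have d3 : is_derive v 1 (fun v : R => Psi (1 + w * v)) (w * g (1 + w * v)).
      by apply: (is_derive_eq (@is_derive1_comp R _ _ v _ _ d2 d1)); rewrite mulrC.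
    by apply: is_derive_eq; rewrite /GRing.scale/=; ring.
  - apply: cvg_at_right_filter.
    have -> : Psi 1 = Psi (1 + w * 0) by rewrite mulr0 addr0.
    apply: cvgM; last exact: cvg_cst.
    apply: (continuous_comp (cD w 0)); apply: continuous_Psi.
    by rewrite mulr0 addr0.
  - apply: cvg_at_left_filter; rewrite upE.
    apply: cvgM; last exact: cvg_cst.
    by apply: (continuous_comp (cD w e)); apply: continuous_Psi; rewrite -upE.
have [up1|up1|up1] := ltrgtP up 1; last first.
- rewrite up1 subrr mul0r; apply: integral0_eq => v _; case: ifPn => // v0.
  rewrite (_ : Num.max _ _ = 0) ?mul0r//; apply/max_idPl.
  rewrite ge_max g_le0 ?up1//=; last by lra.
  by case: ifPn => // v1; rewrite oppr_le0 ltW// g_gt0// up1; apply/andP; split; lra.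
- rewrite -(main 1 (up - 1)); last first.
  + by move=> v ve; rewrite mul1r ltW// g_gt0//; apply/andP; split; lra.
  + by move=> v ve; lra.
  + by lra.
  + by lra.
  + by ring.
  apply: integral_supported => v; rewrite /= in_itv/=.
    move=> /andP[v0 v1]; rewrite v0 !mul1r; congr (_ / _).
    have g0 : 0 < g (1 + v) by rewrite g_gt0//; apply/andP; split; lra.
    rewrite /wl; case: ltP => vv; last by rewrite (max_l (y := 0)) ?max_r ?ltW.
    rewrite (max_l (y := - _)) ?max_r ?ltW//.
    rewrite (lt_trans _ g0)// oppr_lt0 g_gt0//; apply/andP; split; lra.
  move=> h; case: ifPn => // v0.
  have {}h : up - 1 <= v by rewrite leNgt; apply/negP => h'; apply: h; rewrite v0.
  rewrite (_ : Num.max _ _ = 0) ?mul0r//; apply/max_idPl.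
  rewrite ge_max g_le0/=; last by lra.
  by case: ifPn => // v1; rewrite oppr_le0 ltW// g_gt0//; apply/andP; split; lra.
- rewrite -(main (-1) (1 - up)); last first.
  + by move=> v ve; rewrite !mulN1r oppr_ge0 g_le0//; lra.
  + by move=> v ve; lra.
  + by lra.
  + by lra.
  + by ring.
  apply: integral_supported => v; rewrite /= in_itv/=.
    move=> /andP[v0 v1]; rewrite v0 !mulN1r; congr (_ / _).
    have g0 : 0 <= - g (1 - v) by rewrite oppr_ge0 g_le0//; lra.
    rewrite /wl ifT; last by lra.
    by rewrite (max_r (x := g _)) ?max_r// (le_trans _ g0)// g_le0//; lra.
  move=> h; case: ifPn => // v0.
  have {}h : 1 - up <= v by rewrite leNgt; apply/negP => h'; apply: h; rewrite v0.
  rewrite (_ : Num.max _ _ = 0) ?mul0r//; apply/max_idPl.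
  rewrite ge_max g_le0/=; last by lra.
  case: ifPn => // v1; rewrite oppr_le0.
  move: h; rewrite le_eqVlt => /predU1P[e|h].
    have -> : 1 - v = up by lra.
    by rewrite gE// subrr !mul0r.
  by rewrite ltW// g_gt0//; apply/andP; split; lra.
Qed.

Let F (s v : R) : R :=
  if (0 < s) && (0 < v) && (tau * s < v * wl v) then v^-1 else 0.

Lemma measurable_window : measurable_fun [set: R * R] (fun sv => F sv.1 sv.2).
Proof.
apply: measurable_fun_ifT => //.
- apply: measurable_and; last first.
    apply: measurable_fun_ltr; first exact: measurable_funM.
    apply: measurable_funM => //.
    by apply: (measurableT_comp measurable_wl); exact: measurable_snd.
  by apply: measurable_and; apply: measurable_fun_ltr.
- by apply: (measurableT_comp (measurable_invr R)); exact: measurable_snd.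
Qed.

(** For fixed v the admissible s form an interval of length v wl(v)^+/tau; the
    factor v cancels the 1/v coming from the logarithm. *)
Lemma integral_log_ratio (z1 z2 z3 : R -> R[i]) :
  (forall s, 0 < s ->
     sorted_roots R al (tau * s) q x%:C (z1 s) (z2 s) (z3 s)) ->
  (\int[mu]_(s in `]0%R, +oo[) (ln (modulus (z1 s / z2 s)))%:E
   = ((Psi up - Psi 1) / tau)%:E)%E.
Proof.
move=> sol.
have F0 s v : 0 <= F s v.
  by rewrite /F; case: ifP => // /andP[/andP[_ v0] _]; rewrite invr_ge0 ltW.
transitivity (\int[mu]_s \int[mu]_v (F s v)%:E)%E.
  rewrite integral_mkcond; apply: eq_integral => s _.
  rewrite patchE; case: ifPn => [|/negP]; rewrite inE /= in_itv/= andbT => s0.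
    have b0 : 0 < tau * s by rewrite mulr_gt0.
    have w (v : R) (v0 : 0 < v) := uniformized_window _ v _ _ _ b0 v0 (sol _ s0).
    have [m30 m32 _] := positive_window R al _ q x al0 b0 q0 x0 _ _ _ (sol _ s0).
    have m20 : 0 < modulus (z2 s) by exact: lt_trans m32.
    have m21 : modulus (z2 s) <= modulus (z1 s) by case: (sol _ s0).
    have m10 : 0 < modulus (z1 s) by exact: lt_le_trans m21.
    rewrite (integral_supported R
      `]tau * s / modulus (z1 s), tau * s / modulus (z2 s)[%classic
      (fun v => v^-1)).
    - rewrite integral_invr_itv ?divr_gt0//; last first.
        by rewrite ler_pM2l// lef_pV2.
      rewrite modulusM modulusV; congr (ln _)%:E; field.
      by rewrite !gt_eqF.
    - move=> v; rewrite /= in_itv/= => h.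
      have v0 : 0 < v by case/andP: h => + _; apply: lt_trans; rewrite divr_gt0.
      by rewrite /F s0 v0/= -w// h.
    - move=> v; rewrite /= in_itv/= => h.
      rewrite /F s0 /=; case: (ltP 0 v) => //= v0; rewrite -w//.
      by move/negP/negbTE: h => ->.
  by rewrite integral0_eq// => v _; rewrite /F; move/negP/negbTE: s0 => ->.
transitivity (\int[mu]_v \int[mu]_s (F s v)%:E)%E.
  apply: (fubini_tonelli (m1 := mu) (m2 := mu) (fun sv => (F sv.1 sv.2)%:E)).
    by apply/measurable_EFinP; exact: measurable_window.
  by move=> sv; rewrite lee_fin.
rewrite -integral_window_length; apply: eq_integral => v _.
case: ifPn => v0; last first.
  apply: integral0_eq => s _.
  by rewrite /F (negbTE v0) andbF.
rewrite (integral_supported R `]0, v * wl v / tau[%classic (fun=> v^-1)).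
- rewrite integral_cst//= lebesgue_measure_itv/= lte_fin.
  rewrite -mulrA pmulr_rgt0// pmulr_lgt0 ?invr_gt0//.
  case: ltP => h.
    rewrite -EFinD subr0 -EFinM; congr _%:E; field.
    by rewrite !gt_eqF.
  by rewrite mule0 mul0r.
- move=> s; rewrite /= in_itv/= => /andP[s0 s1].
  by rewrite /F s0 v0/= mulrC -ltr_pdivlMr// s1.
- move=> s; rewrite /= in_itv/= => h; rewrite /F v0 andbT.
  case: (ltP 0 s) => //= s0; rewrite mulrC -ltr_pdivlMr//.
  by move/negP: h; rewrite s0 /= => /negbTE ->.
Qed.

End LogRatio.

(** * Roots for negative x in terms of one real parameter *)

Section RootParameter.
Variables (R : realType) (al q : R).
Hypotheses (al0 : 0 < al) (q0 : 0 <= q).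
Implicit Types (X b r : R).

(** For x = -X, the value of b for which the large root zeta of the cubic has
    zeta/(zeta + b) = r. *)
Definition b_at X r : R := (r - 1) * (X * r + q + al / r).

Lemma b_at_lt X r r' : 0 < X -> 1 <= r -> r < r' -> b_at X r < b_at X r'.
Proof.
move=> X0 r1 lt_rr'; rewrite -subr_gt0.
have -> : b_at X r' - b_at X r =
    (r' - r) * (X * (r - 1) + X * r' + q + al / (r * r')).
  by rewrite /b_at; field; apply/andP; split; lra.
have q0' := q0.
have r0 : 0 < r by lra.
have r0' : 0 < r' by lra.
have h1 : 0 <= X * (r - 1) by rewrite mulr_ge0 ?subr_ge0// ltW.
have h2 : 0 < X * r' by rewrite mulr_gt0.
have h3 : 0 < al / (r * r') by rewrite divr_gt0 ?mulr_gt0.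
have h4 : 0 < X * (r - 1) + X * r' + q + al / (r * r') by lra.
by rewrite mulr_gt0 ?subr_gt0.
Qed.

Lemma b_at_surj X b : 0 < X -> 0 < b -> exists r, 1 < r /\ b_at X r = b.
Proof.
move=> X0 b0; have [al0' q0'] : 0 < al /\ 0 <= q by split.
pose P : {poly R} := ('X - 1%:P) * (X *: 'X ^+ 2 + q *: 'X + al%:P) - b *: 'X.
have PE y : P.[y] = (y - 1) * (X * y ^+ 2 + q * y + al) - b * y.
  by rewrite /P !(hornerE, hornerXn)/=.
pose M := 2 + 2 * b / X.
have Mb : 2 * b <= X * M.
  have -> : X * M = 2 * X + 2 * b by rewrite /M; field; rewrite gt_eqF.
  lra.
have M2 : 2 < M by rewrite /M ltrDl divr_gt0// mulr_gt0.
have PM : 0 < P.[M].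
  rewrite PE subr_gt0.
  have h1 : b * M <= 1 * (X * M * M).
    by rewrite mul1r ler_pM2r; lra.
  rewrite (le_lt_trans h1)//; apply: ltr_pM => //; try lra.
    by rewrite !mulr_ge0//; lra.
  have : 0 <= q * M by rewrite mulr_ge0//; lra.
  by lra.
have [||r] := @poly_ivt R P 1 M.
- by lra.
- rewrite PE subrr mul0r sub0r mulr1 oppr_le0 (ltW b0)/=; exact: ltW.
move=> /andP[r1 r2] /rootP; rewrite PE => fr.
have {}r1 : 1 < r.
  rewrite lt_neqAle r1 andbT; apply/eqP => e; move: fr; rewrite -e; lra.
exists r; split=> //.
have rn : r != 0 by lra.
apply: (mulfI rn).
have -> : r * b_at X r = (r - 1) * (X * r ^+ 2 + q * r + al).
  by rewrite /b_at; field.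
lra.
Qed.

Definition root_ratio X b : R := xget 1 [set r | 1 < r /\ b_at X r = b].

Lemma root_ratioP X b : 0 < X -> 0 < b -> 1 < root_ratio X b /\ b_at X (root_ratio X b) = b.
Proof.
move=> X0 b0; have [r hr] := b_at_surj X b X0 b0.
by rewrite /root_ratio; case: xgetP => [y _ //|/(_ r)].
Qed.

Lemma root_ratio_b_at X r : 0 < X -> 1 < r -> root_ratio X (b_at X r) = r.
Proof.
move=> X0 r1; have [y1 e] : 1 < root_ratio X (b_at X r) /\ b_at X (root_ratio X (b_at X r)) = b_at X r.
  by rewrite /root_ratio; case: xgetP => [y _ //|/(_ r)]; case.
have [yr|yr|//] := ltrgtP (root_ratio X (b_at X r)) r.
  by have := b_at_lt X _ _ X0 (ltW y1) yr; rewrite e ltxx.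
by have := b_at_lt X _ _ X0 (ltW r1) yr; rewrite e ltxx.
Qed.

Lemma root_ratio_lt X b c : 0 < X -> 0 < b -> 1 < c -> (root_ratio X b < c) = (b < b_at X c).
Proof.
move=> X0 b0 c1; have [r1 e] := root_ratioP X b X0 b0.
apply/idP/idP => [rc|]; first by rewrite -e; apply: b_at_lt => //; exact: ltW.
rewrite -{1}e; apply: contraTT; rewrite -!leNgt le_eqVlt => /predU1P[<-//|cr].
by apply: ltW; apply: b_at_lt => //; exact: ltW.
Qed.

(** The absolute value of the large root; it is minus the value of
    z(u) = x/u^2 - q/u - al at u = 1/r. *)
Definition big_abs X r : R := X * r ^+ 2 + q * r + al.
(** Half the sum of the two other roots. *)
Definition pair_re X r : R := - ((r - 1) * (X * (r - 1) + q + 2 * al / r) / 2).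
(** X^2 times the square of the imaginary part of 1/u, where u = 1 + b/z for
    the roots z of the pair. *)
Definition pair_disc X r : R := al * X / r - (X * (r - 1) + q) ^+ 2 / 4.
(** The product of the two other roots. *)
Definition pair_norm2 X r : R := al * (r - 1) ^+ 2 * big_abs X r / r ^+ 2.

Section Identities.
Variables X r : R.
Hypotheses (X0 : 0 < X) (r1 : 1 < r).
Let b := b_at X r.

Let r0 : 0 < r. Proof. exact: lt_trans r1. Qed.
Let rn : r != 0. Proof. by rewrite gt_eqF. Qed.

Lemma b_atE : b = (r - 1) * big_abs X r / r.
Proof. by rewrite /b /b_at /big_abs; field. Qed.

Lemma b_at_gt0 : 0 < b.
Proof.
rewrite b_atE divr_gt0// mulr_gt0 ?subr_gt0// ltr_wpDl// addr_ge0 ?mulr_ge0//;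
  by rewrite ?exprn_ge0 ltW.
Qed.

Lemma root_sumE : - big_abs X r + 2 * pair_re X r = - (al + 2 * b + q + X).
Proof. by rewrite /b /b_at /big_abs /pair_re; field. Qed.

Lemma pair_norm2E : pair_re X r ^+ 2 + (r - 1) ^+ 2 * pair_disc X r = pair_norm2 X r.
Proof. by rewrite /pair_re /pair_disc /pair_norm2 /big_abs; field. Qed.

Lemma root_pair_sumE : 2 * pair_re X r * - big_abs X r + pair_norm2 X r = b * (2 * al + b + q).
Proof. by rewrite /b /b_at /pair_norm2 /big_abs /pair_re; field. Qed.

Lemma root_prodE : pair_norm2 X r * - big_abs X r = - (al * b ^+ 2).
Proof. by rewrite /b /b_at /pair_norm2 /big_abs; field. Qed.

Lemma big_abs_gt_al : al < big_abs X r.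
Proof.
by rewrite ltrDr ltr_pwDl ?mulr_gt0 ?exprn_gt0// mulr_ge0// ltW.
Qed.

Lemma big_abs_gt_b : b < big_abs X r.
Proof.
have Q0 : 0 < big_abs X r by apply: lt_trans big_abs_gt_al.
rewrite b_atE ltr_pdivrMr// mulrC ltr_pM2l//; lra.
Qed.

Lemma pair_re_lt0 : pair_re X r < 0.
Proof.
rewrite oppr_lt0 divr_gt0// mulr_gt0 ?subr_gt0//.
have h1 : 0 < X * (r - 1) by rewrite mulr_gt0 ?subr_gt0.
have h2 : 0 < 2 * al / r by rewrite divr_gt0 ?mulr_gt0.
by rewrite ltr_wpDl// addr_ge0// ltW.
Qed.

Lemma pair_norm2_gt0 : 0 < pair_norm2 X r.
Proof.
by rewrite divr_gt0 ?exprn_gt0// !mulr_gt0 ?exprn_gt0 ?subr_gt0// (lt_trans _ big_abs_gt_al).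
Qed.

(** This decides the sign of the derivative of the argument of the pair; it
    holds because the large root exceeds both al and b in absolute value. *)
Lemma pair_norm2_lt_e2 : 3 * pair_norm2 X r < b * (2 * al + b + q).
Proof.
have [al' b' qq] : [/\ 0 < al, 0 < b & 0 <= q] by split=> //; exact: b_at_gt0.
have Q1 := big_abs_gt_al; have Q2 := big_abs_gt_b; have Q0 : 0 < big_abs X r by lra.
rewrite -(ltr_pM2r Q0).
have -> : 3 * pair_norm2 X r * big_abs X r = b * (3 * (al * b)).
  by have := root_prodE; rewrite mulrN => /oppr_inj h; rewrite -mulrA h; ring.
rewrite -[ltRHS]mulrA ltr_pM2l//.
have h1 : 2 * al * b < 2 * al * big_abs X r by rewrite ltr_pM2l ?mulr_gt0.
have h2 : b * al < b * big_abs X r by rewrite ltr_pM2l.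
have h3 : 0 <= q * big_abs X r by rewrite mulr_ge0// ltW.
lra.
Qed.

Lemma pair_norm2_lt : pair_norm2 X r < big_abs X r ^+ 2.
Proof.
have Q1 := big_abs_gt_al; have Q2 := big_abs_gt_b; have b' := b_at_gt0.
have Q0 : 0 < big_abs X r by lra.
rewrite -(ltr_pM2r Q0).
have -> : pair_norm2 X r * big_abs X r = al * b ^+ 2.
  by have := root_prodE; rewrite mulrN => /oppr_inj.
rewrite -exprSr [ltRHS]exprS; apply: ltr_pM; rewrite ?sqr_ge0 ?(ltW al0)//.
by rewrite ltr_pXn2r ?nnegrE// ltW.
Qed.

Lemma pair_sign_gt0 : 0 < pair_re X r * - big_abs X r - pair_norm2 X r.
Proof. by have := pair_norm2_lt_e2; have := root_pair_sumE; lra. Qed.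

End Identities.

(** A double root z satisfies z^3 - e2 z = 2 al b^2, where e2 depends on b only,
    and [pair_norm2_lt_e2] confines it to the interval 3 z^2 < e2, on which the
    left-hand side is injective. *)
Lemma double_root_unique X X' r r' : 0 < X -> 0 < X' -> 1 < r -> 1 < r' ->
  b_at X r = b_at X' r' -> pair_disc X r = 0 -> pair_disc X' r' = 0 -> X = X'.
Proof.
move=> X0 X0' r1 r1' bb k0 k0'.
set b := b_at X r in bb.
have b0 : 0 < b by exact: b_at_gt0.
have P := pair_norm2E X r r1; have P' := pair_norm2E X' r' r1'.
rewrite k0 mulr0 addr0 in P; rewrite k0' mulr0 addr0 in P'.
have e2 := root_pair_sumE X r r1; have e2' := root_pair_sumE X' r' r1'.
have e3 := root_prodE X r r1; have e3' := root_prodE X' r' r1'.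
have e1 := root_sumE X r r1; have e1' := root_sumE X' r' r1'.
have lt := pair_norm2_lt_e2 X r X0 r1; have lt' := pair_norm2_lt_e2 X' r' X0' r1'.
have n := pair_re_lt0 X r X0 r1; have n' := pair_re_lt0 X' r' X0' r1'.
rewrite -/b in e1 e2 e3 lt; rewrite -bb in e1' e2' e3' lt'.
set z := pair_re X r in P e2 e1 n; set z' := pair_re X' r' in P' e2' e1' n'.
rewrite -P in e2 e3 lt; rewrite -P' in e2' e3' lt'.
set E2 := b * (2 * al + b + q) in e2 e2' lt lt'.
have g : z ^+ 3 - E2 * z = 2 * (al * b ^+ 2).
  by apply: (lincomb2 _ z _ _ (-2) _ _ _ _ e2 e3); ring.
have g' : z' ^+ 3 - E2 * z' = 2 * (al * b ^+ 2).
  by apply: (lincomb2 _ z' _ _ (-2) _ _ _ _ e2' e3'); ring.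
have : (z - z') * (z ^+ 2 + z * z' + z' ^+ 2 - E2) = 0.
  by apply: (lincomb2 _ 1 _ _ (-1) _ _ _ _ g g'); ring.
move/eqP; rewrite mulf_eq0 => /orP[/eqP zz|/eqP abs]; last by nra.
have {}zz : z = z' by lra.
have : z * (big_abs X r - big_abs X' r') = 0 by rewrite zz in e2 *; lra.
move/eqP; rewrite mulf_eq0 => /orP[/eqP|/eqP]; lra.
Qed.

End RootParameter.

Section NegativeX.
Variables (R : realType) (al q : R).
Hypotheses (al0 : 0 < al) (q0 : 0 <= q).
Variables (X r : R).
Hypotheses (X0 : 0 < X) (r1 : 1 < r).

Notation b := (b_at R al q X r).
Notation Q := (big_abs R al q X r).
Notation xi0 := (pair_re R al q X r).
Notation k := (pair_disc R al q X r).
Notation P := (pair_norm2 R al q X r).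

Definition pair_im : R := (r - 1) * Num.sqrt k.

Lemma pair_norm2_im : 0 <= k -> xi0 ^+ 2 + pair_im ^+ 2 = P.
Proof. by move=> k0; rewrite -pair_norm2E// /pair_im exprMn sqr_sqrtr. Qed.

Lemma negative_x_conjugate_roots : 0 <= k ->
  cubic_roots (R[i]) ((al + 2 * b + q)%:C - (- X)%:C)
    (b * (2 * al + b + q))%:C (al * b ^+ 2)%:C
    (- Q)%:C (xi0 -i* pair_im) (xi0 +i* pair_im).
Proof.
move=> k0; have P2 := pair_norm2_im k0.
have e1 := root_sumE R al q X r r1; have e2 := root_pair_sumE R al q X r r1.
have e3 := root_prodE R al q X r r1.
split; apply/eqP; rewrite eq_complex /=; apply/andP; split; apply/eqP.
- by move: e1; lra.
- by ring.
- by rewrite -e2 -P2; ring.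
- by ring.
- by rewrite -e3 -P2; ring.
- by ring.
Qed.

Lemma negative_x_moduli (z1 z2 z3 : R[i]) : 0 <= k ->
  sorted_roots R al b q (- X)%:C z1 z2 z3 -> modulus z2 = modulus z3.
Proof.
move=> k0 [Z z21 z32]; have U := negative_x_conjugate_roots k0.
have mm : modulus (xi0 +i* pair_im) = modulus (xi0 -i* pair_im).
  by rewrite !modulus_pair (sqrrN pair_im).
have [||_ -> ->] := sorted_moduli _ _ _ _ _ _ _ _ _ _ Z U z21 z32; rewrite ?mm//.
rewrite modulus_real normrN modulus_pair (sqrrN pair_im) pair_norm2_im// -sqrtr_sqr.
by rewrite ler_wsqrtr// ltW// pair_norm2_lt.
Qed.

(** The case of three real roots: the two small ones are negative and distinct,
    so it only remains to see that they are smaller than the third. *)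
Lemma negative_x_moduli_lt (z1 z2 z3 : R[i]) : k < 0 ->
  sorted_roots R al b q (- X)%:C z1 z2 z3 -> modulus z3 < modulus z2.
Proof.
move=> k0 [Z z21 z32].
pose d := (r - 1) * Num.sqrt (- k).
have kn : 0 < - k by rewrite oppr_gt0.
have d0 : 0 < d by rewrite mulr_gt0 ?sqrtr_gt0// subr_gt0.
have d2 : xi0 ^+ 2 - d ^+ 2 = P.
  by rewrite -pair_norm2E// /d exprMn sqr_sqrtr ?(ltW kn)// mulrN opprK.
have P0 := pair_norm2_gt0 R al q al0 q0 X r X0 r1.
have n := pair_re_lt0 R al q al0 q0 X r X0 r1.
have Q1 := big_abs_gt_al R al q q0 X r X0 r1.
have Q2 := big_abs_gt_b R al q al0 q0 X r X0 r1.
have b0 := b_at_gt0 R al q al0 q0 X r X0 r1.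
have e1 := root_sumE R al q X r r1; have e2 := root_pair_sumE R al q X r r1.
have e3 := root_prodE R al q X r r1.
have al0' := al0; have X0' := X0; have q0' := q0.
have U : cubic_roots (R[i]) ((al + 2 * b + q)%:C - (- X)%:C)
    (b * (2 * al + b + q))%:C (al * b ^+ 2)%:C
    (- Q)%:C (xi0 - d)%:C (xi0 + d)%:C.
  split; rewrite -?(rmorphD, rmorphB, rmorphN, rmorphM); congr (_%:C).
  - by lra.
  - by rewrite -e2 -d2; ring.
  - by rewrite -e3 -d2; ring.
have dn : xi0 + d < 0.
  rewrite ltNge; apply/negP => h.
  have : (xi0 + d) * (xi0 - d) <= 0 by rewrite mulr_ge0_le0//; lra.
  have -> : (xi0 + d) * (xi0 - d) = P by rewrite -d2; ring.
  lra.
(* The cubic takes the value X b^2 > 0 at -b, so both roots are on the same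
   side of -b; beyond -b, their product would be too large. *)
have side : 0 < (b + (xi0 - d)) * (b + (xi0 + d)).
  have h : (Q - b) * ((b + (xi0 - d)) * (b + (xi0 + d))) = X * b ^+ 2.
    have -> : (b + (xi0 - d)) * (b + (xi0 + d)) = b ^+ 2 + 2 * xi0 * b + P.
      by rewrite -d2; ring.
    by apply: (lincomb3 _ (- b ^+ 2) _ _ (- b) _ _ (-1) _ _ _ _ e1 e2 e3); ring.
  have : 0 < X * b ^+ 2 by rewrite mulr_gt0// exprn_gt0.
  by rewrite -h pmulr_rgt0// subr_gt0.
have small : - (xi0 - d) < b.
  rewrite ltNge; apply/negP => h.
  have h' : b <= - (xi0 + d).
    rewrite leNgt; apply/negP => h2.
    have : (b + (xi0 - d)) * (b + (xi0 + d)) <= 0 by rewrite mulr_le0_ge0//; lra.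
    lra.
  have : b * b <= (- (xi0 - d)) * (- (xi0 + d)).
    by apply: ler_pM => //; exact: ltW.
  have -> : (- (xi0 - d)) * (- (xi0 + d)) = P by rewrite -d2; ring.
  move=> bP; have : b * b * Q <= P * Q by rewrite ler_pM2r//; lra.
  have : al * (b * b) < b * b * Q by rewrite mulrC ltr_pM2l// mulr_gt0.
  by move: e3; rewrite expr2; lra.
have md : modulus (xi0 - d)%:C = - (xi0 - d) by rewrite modulus_real ltr0_norm//; lra.
have mD : modulus (xi0 + d)%:C = - (xi0 + d) by rewrite modulus_real ltr0_norm//; lra.
have mQ : modulus (- Q)%:C = Q by rewrite modulus_real normrN gtr0_norm//; lra.
have [||_ -> ->] := sorted_moduli _ _ _ _ _ _ _ _ _ _ Z U z21 z32;
  rewrite ?md ?mD ?mQ; lra.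
Qed.

End NegativeX.

(** * Continuity of roots and boundary values *)

Section RootContinuity.
Variable R : realType.
Implicit Types (z u w : R[i]).

Lemma le_modulusD z u : modulus (z + u) <= modulus z + modulus u.
Proof. exact: (le_normcD (z : Rcomplex R) u). Qed.

Lemma modulusN z : modulus (- z) = modulus z.
Proof. exact: (normcN (z : Rcomplex R)). Qed.

Lemma le_modulus_via u v z : modulus (u - v) <= modulus (u - z) + modulus (v - z).
Proof.
rewrite -[X in _ <= _ + X]modulusN (le_trans _ (le_modulusD _ _))//.
by have -> : u - z + - (v - z) = u - v by ring.
Qed.

Lemma le_modulus_sub u z : modulus u <= modulus (u - z) + modulus z.
Proof. by rewrite (le_trans _ (le_modulusD _ _))// subrK. Qed.

Lemma le_modulus_sub' u z : modulus z <= modulus (u - z) + modulus u.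
Proof.
by rewrite -(modulusN (u - z)) (le_trans _ (le_modulusD _ _))// opprB subrK.
Qed.

Lemma modulus_eq0 z : (modulus z == 0) = (z == 0).
Proof.
apply/eqP/eqP => [/ComplexField.Normc.eq0_normc//|->].
by rewrite /modulus/= expr0n/= addr0 sqrtr0.
Qed.

Lemma modulus_sub_gt0 z u : z != u -> 0 < modulus (z - u).
Proof. by move=> zu; rewrite lt_def modulus_eq0 subr_eq0 zu modulus_ge0. Qed.

(** If u solves the unperturbed cubic, the product of its distances to the new
    roots is |h||u|^2, so some new root is within its cube root.  Once this
    bound is below the separation of the old roots, distinct old roots have
    distinct neighbours, and the ordering of moduli attaches z1 to u1. *)
Lemma cubic_roots_continuous (c2 c1 c0 u1 u2 u3 : R[i]) (e : R) :
  cubic_roots (R[i]) c2 c1 c0 u1 u2 u3 ->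
  u2 != u3 -> modulus u2 < modulus u1 -> modulus u3 < modulus u1 -> 0 < e ->
  exists2 d : R, 0 < d & forall h z1 z2 z3 : R[i], modulus h < d ->
    cubic_roots (R[i]) (c2 - h) c1 c0 z1 z2 z3 ->
    modulus z2 <= modulus z1 -> modulus z3 <= modulus z2 ->
    modulus (u2 - z2) < e /\ modulus (u3 - z3) < e \/
    modulus (u3 - z2) < e /\ modulus (u2 - z3) < e.
Proof.
move=> U u23 u21 u31 e0.
have [e1 [e10 e1e s23 s12 s13]] : exists e1 : R, [/\ 0 < e1, e1 <= e,
    2 * e1 <= modulus (u2 - u3), 2 * e1 <= modulus u1 - modulus u2 &
    2 * e1 <= modulus u1 - modulus u3].
  have h1 := modulus_sub_gt0 _ _ u23.
  pose m1 := Num.min e (modulus (u2 - u3) / 2).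
  pose m2 := Num.min (modulus u1 - modulus u2) (modulus u1 - modulus u3).
  exists (Num.min m1 (m2 / 2)).
  have [a1 a2] : m1 <= e /\ m1 <= modulus (u2 - u3) / 2.
    by rewrite /m1 !ge_min !lexx orbT.
  have [b1 b2] : m2 <= modulus u1 - modulus u2 /\ m2 <= modulus u1 - modulus u3.
    by rewrite /m2 !ge_min !lexx orbT.
  have m10 : 0 < m1 by rewrite lt_min e0 divr_gt0.
  have m20 : 0 < m2 by rewrite lt_min !subr_gt0 u21.
  have [c1' c2'] : Num.min m1 (m2 / 2) <= m1 /\ Num.min m1 (m2 / 2) <= m2 / 2.
    by split; rewrite ge_min lexx ?orbT.
  split; [by rewrite lt_min m10 divr_gt0|lra..].
pose M := 1 + modulus u1 ^+ 2 + modulus u2 ^+ 2 + modulus u3 ^+ 2.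
have M0 : 0 < M by rewrite !ltr_wpDr// sqr_ge0.
exists (e1 ^+ 3 / M); first by rewrite divr_gt0// exprn_gt0.
move=> h z1 z2 z3 hd Z z21 z32.
have near u : u ^+ 3 + c2 * u ^+ 2 + c1 * u + c0 = 0 -> modulus u ^+ 2 <= M ->
    [\/ modulus (u - z1) < e1, modulus (u - z2) < e1 | modulus (u - z3) < e1].
  move=> fu uM.
  have prod : modulus (u - z1) * modulus (u - z2) * modulus (u - z3) < e1 ^+ 3.
    rewrite -!modulusM -(cubic_rootsE _ _ _ _ _ _ _ Z).
    have -> : u ^+ 3 + (c2 - h) * u ^+ 2 + c1 * u + c0 = - (h * (u * u)).
      by apply: (lincomb1 _ 1 _ _ _ _ fu); ring.
    rewrite modulusN !modulusM -expr2.
    move: hd; rewrite ltr_pdivlMr// => hd1; apply: le_lt_trans hd1.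
    by rewrite ler_wpM2l// modulus_ge0.
  have [c|n1] := ltP (modulus (u - z1)) e1; first exact: Or31.
  have [c|n2] := ltP (modulus (u - z2)) e1; first exact: Or32.
  have [c|n3] := ltP (modulus (u - z3)) e1; first exact: Or33.
  move: prod; rewrite ltNge => /negP; case.
  have -> : e1 ^+ 3 = e1 * e1 * e1 by ring.
  by apply: ler_pM => //; rewrite ?mulr_ge0 ?(ltW e10)// ler_pM ?(ltW e10).
have sq u := sqr_ge0 (modulus u).
have N1 : [\/ modulus (u1 - z1) < e1, modulus (u1 - z2) < e1
            | modulus (u1 - z3) < e1].
  apply: near; first by rewrite (cubic_rootsE _ _ _ _ _ _ _ U) subrr !mul0r.
  by have := (sq u1, sq u2, sq u3); rewrite /M => -[[]]; lra.
have N2 : [\/ modulus (u2 - z1) < e1, modulus (u2 - z2) < e1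
            | modulus (u2 - z3) < e1].
  apply: near; first by rewrite (cubic_rootsE _ _ _ _ _ _ _ U) subrr mulr0 mul0r.
  by have := (sq u1, sq u2, sq u3); rewrite /M => -[[]]; lra.
have N3 : [\/ modulus (u3 - z1) < e1, modulus (u3 - z2) < e1
            | modulus (u3 - z3) < e1].
  apply: near; first by rewrite (cubic_rootsE _ _ _ _ _ _ _ U) subrr mulr0.
  by have := (sq u1, sq u2, sq u3); rewrite /M => -[[]]; lra.
have t1 := le_modulus_via u2 u3 z1; have t2 := le_modulus_via u2 u3 z2.
have t3 := le_modulus_via u2 u3 z3.
have m1 := le_modulus_sub u1 z1; have m2 := le_modulus_sub u1 z2.
have m3 := le_modulus_sub u1 z3.
have a1 := le_modulus_sub' u2 z1; have a2 := le_modulus_sub' u2 z2.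
have a3 := le_modulus_sub' u2 z3.
have b1 := le_modulus_sub' u3 z1; have b2 := le_modulus_sub' u3 z2.
have b3 := le_modulus_sub' u3 z3.
clear -N1 N2 N3 t1 t2 t3 m1 m2 m3 a1 a2 a3 b1 b2 b3 z21 z32 s23 s12 s13 e10 e1e.
case: N1 => n1; case: N2 => n2; case: N3 => n3; try (exfalso; lra).
- by left; split; lra.
- by right; split; lra.
Qed.

End RootContinuity.

Lemma cvg_pairing (K : numFieldType) (T : Type) (F : set_system T)
    (FF : Filter F) (f g : T -> K^o) (u E C : K) :
  u != 0 -> f @ F --> (u : K^o) -> g @ F --> (u : K^o) ->
  ((f t + g t) - E * ((f t)^-1 + (g t)^-1)
     - C * (((f t)^-1 + (g t)^-1) * ((f t)^-1 + (g t)^-1)) : K^o) @[t --> F]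
  --> ((u + u) - E * (u^-1 + u^-1) - C * ((u^-1 + u^-1) * (u^-1 + u^-1)) : K^o).
Proof.
move=> u0 fu gu.
have fgV : ((f t)^-1 + (g t)^-1 : K^o) @[t --> F] --> (u^-1 + u^-1 : K^o).
  by apply: cvgD; apply: cvgV.
apply: cvgB; first (apply: cvgB; first exact: cvgD).
  by apply: cvgM => //; exact: cvg_cst.
by apply: cvgM; [exact: cvg_cst|exact: cvgM].
Qed.

Section BranchSelection.
Variable R : realType.
Implicit Types (p m u w : R[i]).

Lemma complexV (x y : R) :
  (x +i* y)^-1 = (x / (x ^+ 2 + y ^+ 2)) -i* (y / (x ^+ 2 + y ^+ 2)).
Proof. by []. Qed.

(** For A(z) = z + c + E/z + C/z^2 one has
    A(p) - A(m) = (p - m) Q(p, m), and this is (p + m) Q(p, m).  At p = m = z it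
    is 2 z A'(z). *)
Definition pairing (E C : R) p m : R[i] :=
  (p + m) - E%:C * (p^-1 + m^-1) - C%:C * ((p^-1 + m^-1) * (p^-1 + m^-1)).

Lemma pairing_continuous (E C : R) (u : R[i]) (e : R) : u != 0 -> 0 < e ->
  exists2 d : R, 0 < d & forall p m, modulus (p - u) < d ->
    modulus (m - u) < d -> modulus (pairing E C p m - pairing E C u u) < e.
Proof.
move=> u0 e0.
have cF : (pairing E C pm.1 pm.2 : R[i]^o) @[pm --> ((u : R[i]^o), (u : R[i]^o))]
    --> (pairing E C u u : R[i]^o).
  have c1 : (pm.1 : R[i]^o) @[pm --> ((u : R[i]^o), (u : R[i]^o))] --> (u : R[i]^o).
    exact: cvg_fst.
  have c2 : (pm.2 : R[i]^o) @[pm --> ((u : R[i]^o), (u : R[i]^o))] --> (u : R[i]^o).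
    exact: cvg_snd.
  exact: (@cvg_pairing (R[i]) _ _ _ _ _ u E%:C C%:C u0 c1 c2).
have : \forall pm \near ((u : R[i]^o), (u : R[i]^o)),
    `|pairing E C u u - pairing E C pm.1 pm.2| < e%:C.
  by move/cvgrPdist_lt : cF; apply; rewrite ltcR.
move=> [[A B] /= [/nbhs_ballP[d1 d10 A1] /nbhs_ballP[d2 d20 B1]] AB].
have real_of (d : R[i]) : 0 < d -> d = (complex.Re d)%:C /\ 0 < complex.Re d.
  by case: d => x y; rewrite ltcE /= => /andP[/eqP ->].
have [e1 p1] := real_of _ d10; have [e2 p2] := real_of _ d20.
exists (Num.min (complex.Re d1) (complex.Re d2)); first by rewrite lt_min p1.
move=> p m; rewrite !lt_min => /andP[pd _] /andP[_ md].
rewrite -ltcR modulus_norm -normrN opprB; apply: (AB (p, m)); split=> /=.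
  by apply: A1; rewrite -ball_normE /= e1 -normrN opprB -modulus_norm ltcR.
by apply: B1; rewrite -ball_normE /= e2 -normrN opprB -modulus_norm ltcR.
Qed.

(** Expresses the comparison of |p| and |m| by a product with p - m. *)
Lemma Re_mulc_conj p m :
  complex.Re ((p - m) * (conjc (p + m))) = modulus p ^+ 2 - modulus m ^+ 2.
Proof.
case: p => p1 p2; case: m => m1 m2; rewrite !sqr_modulus /=; ring.
Qed.

(** Take p = z2 and m the conjugate of z3.  Both solve the equation, with
    conjugate right-hand sides w and conj w, so (p - m) F = 2i Im(w) (p + m) for
    the pairing F, and |p|^2 - |m|^2 has the sign of Im(w) Im(F). *)
Lemma pairing_sign (c E C : R) w p m :
  p != 0 -> m != 0 -> p + m != 0 ->
  p ^+ 3 + (c%:C - w) * p ^+ 2 + E%:C * p + C%:C = 0 ->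
  m ^+ 3 + (c%:C - conjc w) * m ^+ 2 + E%:C * m + C%:C = 0 ->
  complex.Im w * complex.Im (pairing E C p m) < 0 ->
  modulus p < modulus m.
Proof.
move=> p0 m0 pm0 Hp Hm sgn.
set F := pairing E C p m in sgn.
have H1 : (p - m) * F = (w - conjc w) * (p + m).
  have -> : w - conjc w = p - m + E%:C * (p^-1 - m^-1) + C%:C * (p^-2 - m ^- 2).
    have -> : conjc w = m + c%:C + E%:C / m + C%:C * m ^- 2.
      by apply: (lincomb1 _ (- m ^- 2) _ _ _ _ Hm); field.
    have -> : w = p + c%:C + E%:C / p + C%:C * p ^- 2.
      by apply: (lincomb1 _ (- p ^- 2) _ _ _ _ Hp); field.
    by ring.
  rewrite /F /pairing; field.
  by apply/andP.
pose T := (p - m) * (conjc (p + m)).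
have H2 : T * F = (w - conjc w) * ((p + m) * (conjc (p + m))).
  by rewrite /T mulrAC H1; ring.
have H3 : (p + m) * (conjc (p + m)) = (modulus (p + m) ^+ 2)%:C.
  rewrite -sqr_normc -modulus_norm -rmorphXn//.
have N0 : 0 < modulus (p + m) ^+ 2 by rewrite exprn_gt0// lt_def modulus_eq0 pm0 modulus_ge0.
set N := modulus (p + m) ^+ 2 in H3 N0.
have TE : complex.Re T = modulus p ^+ 2 - modulus m ^+ 2 by exact: Re_mulc_conj.
rewrite H3 in H2.
move: H2 TE sgn; case: (T) => T1 T2; case: (F) => F1 F2; case: (w) => w1 w2.
move=> /eqP; rewrite eq_complex /= => /andP[/eqP r1 /eqP r2] TE /= sgn.
have H : T1 * (F1 ^+ 2 + F2 ^+ 2) = 2 * N * (w2 * F2).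
  by apply: (lincomb2 _ F1 _ _ F2 _ _ _ _ r1 r2); ring.
have : T1 < 0.
  rewrite ltNge; apply/negP => T10.
  have h1 : 0 <= T1 * (F1 ^+ 2 + F2 ^+ 2).
    by rewrite mulr_ge0// addr_ge0// sqr_ge0.
  have h2 : 2 * N * (w2 * F2) < 0 by rewrite pmulr_rlt0; [exact: sgn|rewrite mulr_gt0].
  by move: h1; rewrite H; lra.
rewrite TE subr_lt0; rewrite ltr_pXn2r// ?nnegrE; exact: modulus_ge0.
Qed.

End BranchSelection.

Section BranchLimit.
Variables (R : realType) (al q : R).
Hypotheses (al0 : 0 < al) (q0 : 0 <= q).
Variables (X r : R).
Hypotheses (X0 : 0 < X) (r1 : 1 < r).

Notation b := (b_at R al q X r).
Notation Q := (big_abs R al q X r).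
Notation xi0 := (pair_re R al q X r).
Notation k := (pair_disc R al q X r).
Notation P := (pair_norm2 R al q X r).
Notation eta0 := (pair_im R al q X r).

Hypothesis k0 : 0 < k.

Lemma pair_im_gt0 : 0 < eta0.
Proof. by rewrite /pair_im mulr_gt0 ?sqrtr_gt0// subr_gt0. Qed.

(** This is Im(2 z A'(z)) at a member z of the conjugate pair. *)
Lemma Im_pairing_diag (y : R) : xi0 ^+ 2 + y ^+ 2 = P ->
  complex.Im (pairing R (b * (2 * al + b + q)) (al * b ^+ 2)
                (xi0 +i* y) (xi0 +i* y)) =
  - (4 * y * ((xi0 * - Q - P) / P)).
Proof.
move=> yP; have P0 := pair_norm2_gt0 R al q al0 q0 X r X0 r1.
have e2 := root_pair_sumE R al q X r r1; have e3 := root_prodE R al q X r r1.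
have -> : al * b ^+ 2 = P * Q by rewrite -[LHS]opprK -e3; ring.
rewrite -e2 /pairing complexV yP /=.
have Pn : P != 0 by rewrite gt_eqF.
move: yP Pn; set P' := P; set x := xi0; set Q' := Q => yP Pn.
have {}yP : P' = x ^+ 2 + y ^+ 2 by [].
field. exact: Pn.
Qed.

(** The two small roots stay close to the conjugate pair.  The assignment that
    would make z2 approach the wrong member is excluded by [pairing_sign],
    since |z3| <= |z2|. *)
Lemma branch_limit (e : R) : 0 < e ->
  exists2 d : R, 0 < d & forall w z1 z2 z3 : R[i],
    sorted_roots R al b q w z1 z2 z3 -> modulus (w - (- X)%:C) < d ->
    (0 < complex.Im w -> modulus (z2 - (xi0 -i* eta0)) < e) /\
    (complex.Im w < 0 -> modulus (z2 - (xi0 +i* eta0)) < e).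
Proof.
move=> e0; have eta0_gt0 := pair_im_gt0.
have U := negative_x_conjugate_roots R al q X r r1 (ltW k0).
set up := xi0 +i* eta0 in U *; set dn := xi0 -i* eta0 in U *.
have eP := pair_norm2_im R al q X r r1 (ltW k0).
have P0 := pair_norm2_gt0 R al q al0 q0 X r X0 r1.
have mup : modulus up = Num.sqrt P by rewrite modulus_pair eP.
have mdn : modulus dn = Num.sqrt P by rewrite modulus_pair (sqrrN eta0) eP.
have sP0 : 0 < Num.sqrt P by rewrite sqrtr_gt0.
have neg : 0 < (xi0 * - Q - P) / P by rewrite divr_gt0// pair_sign_gt0.
set E2 := b * (2 * al + b + q) in U *; set C := al * b ^+ 2 in U *.
have Iup : complex.Im (pairing R E2 C up up) < 0.
  rewrite /up Im_pairing_diag// oppr_lt0.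
  by apply: mulr_gt0 neg; rewrite mulr_gt0.
have Idn : 0 < complex.Im (pairing R E2 C dn dn).
  rewrite /dn Im_pairing_diag ?(sqrrN eta0)//.
  have -> c : - (4 * - eta0 * c) = 4 * eta0 * c by ring.
  by apply: mulr_gt0 neg; rewrite mulr_gt0.
have dn_up : dn != up.
  by rewrite /dn /up eq_complex /= negb_and orbC; apply/orP; left; lra.
have mQ : modulus (- Q)%:C = Q.
  rewrite modulus_real normrN gtr0_norm// (lt_trans _ (big_abs_gt_al _ _ _ q0 _ _ _ _)) //.
have sPQ : Num.sqrt P < Q.
  have Q0 : 0 < Q by apply: lt_trans (big_abs_gt_al _ _ _ q0 _ _ _ _).
  by rewrite -(gtr0_norm Q0) -sqrtr_sqr ltr_sqrt ?exprn_gt0// pair_norm2_lt.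
have up0 : up != 0 by rewrite -modulus_eq0 mup gt_eqF.
have dn0 : dn != 0 by rewrite -modulus_eq0 mdn gt_eqF.
have [d1 d10 H1] := pairing_continuous R E2 C up (- complex.Im (pairing R E2 C up up))
  up0 ltac:(by rewrite oppr_gt0).
have [d2 d20 H2] := pairing_continuous R E2 C dn _ dn0 Idn.
pose e1 := Num.min (Num.min e (Num.sqrt P)) (Num.min d1 d2).
have e10 : 0 < e1 by rewrite !lt_min e0 sP0 d10.
have [e1e e1P e1d1 e1d2] : [/\ e1 <= e, e1 <= Num.sqrt P, e1 <= d1 & e1 <= d2].
  by split; rewrite /e1 !ge_min lexx ?orbT.
have mdnQ : modulus dn < modulus (- Q)%:C by rewrite mdn mQ.
have mupQ : modulus up < modulus (- Q)%:C by rewrite mup mQ.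
have [d d0 H] := cubic_roots_continuous R _ _ _ _ _ _ e1 U dn_up mdnQ mupQ e10.
exists d => // w z1 z2 z3 [Z z21 z32] wd.
have Z' : cubic_roots (R[i]) ((al + 2 * b + q)%:C - (- X)%:C - (w - (- X)%:C))
    E2%:C C%:C z1 z2 z3.
  suff -> : (al + 2 * b + q)%:C - (- X)%:C - (w - (- X)%:C) =
     (al + 2 * b + q)%:C - w by [].
  by ring.
have mj (u v : R[i]) : modulus (conjc u - conjc v) = modulus (v - u).
  by case: u => ? ?; case: v => ? ?; rewrite !modulus_pair; congr Num.sqrt; ring.
(* The larger root cannot approach the member u of the conjugate pair at which
   the pairing has the sign opposite to that of the imaginary part of w. *)
have exclude u : modulus u = Num.sqrt P ->
    (forall p m, modulus (p - u) < e1 -> modulus (m - u) < e1 ->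
       complex.Im w * complex.Im (pairing R E2 C p m) < 0) ->
    modulus (u - z2) < e1 -> modulus (conjc u - z3) < e1 -> False.
  move=> mu sgn u2 u3.
  have u2' : modulus (z2 - u) < e1 by rewrite -modulusN opprB.
  have u3' : modulus (conjc z3 - u) < e1.
    by rewrite -[u]conjcK mj.
  have s := sgn _ _ u2' u3'.
  have nz p : modulus (p - u) < e1 -> p != 0.
    move=> h; apply/eqP => p0; move: h; rewrite p0 sub0r modulusN mu; lra.
  have sum0 : z2 + conjc z3 != 0.
    apply/eqP => p0; have : modulus (u + u) <= modulus (z2 - u) + modulus (conjc z3 - u).
      rewrite -modulusN -(addr0 (- (u + u))) -p0.
      apply: le_trans (le_modulusD _ _ _).
      by rewrite le_eqVlt; apply/orP; left; apply/eqP; congr modulus; ring.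
    have -> : u + u = 2%:C * u by rewrite rmorph_nat; ring.
    by rewrite modulusM modulus_real mu ger0_norm//; lra.
  have e2 : z2 ^+ 3 + ((al + 2 * b + q)%:C - w) * z2 ^+ 2 + E2%:C * z2 + C%:C = 0.
    by rewrite (cubic_rootsE _ _ _ _ _ _ _ Z) subrr mulr0 mul0r.
  have e3 : z3 ^+ 3 + ((al + 2 * b + q)%:C - w) * z3 ^+ 2 + E2%:C * z3 + C%:C = 0.
    by rewrite (cubic_rootsE _ _ _ _ _ _ _ Z) subrr mulr0.
  have e3' : conjc z3 ^+ 3 + ((al + 2 * b + q)%:C - conjc w) * conjc z3 ^+ 2
      + E2%:C * conjc z3 + C%:C = 0.
    move/(congr1 (@conjc R)) : e3.
    by rewrite !(rmorphD, rmorphN, rmorphM, rmorphXn, rmorph0)/= !oppr0.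
  have := pairing_sign R _ _ _ w _ _ (nz _ u2') (nz _ u3') sum0 e2 e3' s.
  have -> : modulus (conjc z3) = modulus z3.
    by case: (z3) => ? ?; rewrite /conjc !modulus_pair sqrrN.
  by lra.
have ImB (u v : R[i]) : `|complex.Im u - complex.Im v| <= modulus (u - v).
  case: u => u1 u2; case: v => v1 v2; rewrite modulus_pair /= -sqrtr_sqr.
  by rewrite ler_wsqrtr// lerDr sqr_ge0.
split=> wpos.
- have [[h1 h2]|[h1 h2]] := H _ _ _ _ wd Z' z21 z32.
    by rewrite -modulusN opprB; exact: lt_le_trans e1e.
  exfalso; apply: (exclude up mup _ h1).
  + move=> p m pu mu; rewrite pmulr_rlt0//.
    have := H1 p m (lt_le_trans pu e1d1) (lt_le_trans mu e1d1).
    move=> /(le_lt_trans (ImB _ _)); rewrite ltr_norml => /andP[_]; lra.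
  + by rewrite /up /=.
- have [[h1 h2]|[h1 h2]] := H _ _ _ _ wd Z' z21 z32; last first.
    by rewrite -modulusN opprB; exact: lt_le_trans e1e.
  exfalso; apply: (exclude dn mdn _ h1).
  + move=> p m pu mu; rewrite nmulr_rlt0//.
    have := H2 p m (lt_le_trans pu e1d2) (lt_le_trans mu e1d2).
    move=> /(le_lt_trans (ImB _ _)); rewrite ltr_norml => /andP[]; lra.
  + by rewrite /dn /= opprK.
Qed.

End BranchLimit.

Section HalfPlaneLimits.
Variable R : realType.

(** The first hypothesis makes the filter of neighbourhoods within H proper, so
    that the limit is unique. *)
Lemma lim_within_half_plane (H : set R[i]^o) (f : R[i] -> R[i]) (x : R) (l : R[i]) :
  (forall e : R, 0 < e -> exists w, H w /\ modulus (w - x%:C) < e) ->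
  (forall e : R, 0 < e -> exists2 d : R, 0 < d &
     forall w, H w -> modulus (w - x%:C) < d -> modulus (f w - l) < e) ->
  lim ((f w : R[i]^o) @[w --> within H (nbhs (x%:C : R[i]^o))]) = l.
Proof.
move=> Hx fl.
have real_of (d : R[i]) : 0 < d -> d = (complex.Re d)%:C /\ 0 < complex.Re d.
  by case: d => y z; rewrite ltcE /= => /andP[/eqP ->].
have PF : ProperFilter (within H (nbhs (x%:C : R[i]^o))).
  apply: Build_ProperFilter_ex => P /nbhs_ballP[d d0 dP].
  have [de d0'] := real_of _ d0.
  have [w [Hw wd]] := Hx _ d0'.
  exists w; apply: dP => //.
  by rewrite -ball_normE /= de -normrN opprB -modulus_norm ltcR.
apply: (@cvg_lim R[i]^o); first exact: norm_hausdorff.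
apply/cvgrPdist_lt => e e0; have [ee e0'] := real_of _ e0.
have [d d0 dP] := fl _ e0'.
rewrite near_withinE; apply/nbhs_ballP; exists d%:C; first by rewrite /= ltcR.
move=> w; rewrite -ball_normE /= -normrN opprB -modulus_norm ltcR => wd Hw.
by rewrite -normrN opprB -modulus_norm ee ltcR; exact: dP.
Qed.

Lemma upper_limit_eq (f : R[i] -> R[i]) (x : R) (l : R[i]) :
  (forall e : R, 0 < e -> exists2 d : R, 0 < d & forall w : R[i],
     0 < complex.Im w -> modulus (w - x%:C) < d -> modulus (f w - l) < e) ->
  upper_limit f x = l.
Proof.
move=> fl; apply: lim_within_half_plane fl => e e0.
exists (x +i* (e / 2)); split; first by rewrite /= divr_gt0.
have -> : (x +i* (e / 2)) - x%:C = 0 +i* (e / 2).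
  by apply/eqP; rewrite eq_complex /= subrr oppr0 addr0 !eqxx.
by rewrite modulus_pair expr0n add0r sqrtr_sqr gtr0_norm ?divr_gt0//; lra.
Qed.

Lemma lower_limit_eq (f : R[i] -> R[i]) (x : R) (l : R[i]) :
  (forall e : R, 0 < e -> exists2 d : R, 0 < d & forall w : R[i],
     complex.Im w < 0 -> modulus (w - x%:C) < d -> modulus (f w - l) < e) ->
  lower_limit f x = l.
Proof.
move=> fl; apply: lim_within_half_plane fl => e e0.
exists (x -i* (e / 2)); split; first by rewrite /= oppr_lt0 divr_gt0.
have -> : (x -i* (e / 2)) - x%:C = 0 -i* (e / 2).
  by apply/eqP; rewrite eq_complex /= subrr oppr0 addr0 !eqxx.
rewrite modulus_pair (sqrrN (e / 2)) expr0n add0r sqrtr_sqr gtr0_norm ?divr_gt0//.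
by lra.
Qed.

(** The jump of the logarithmic derivative between conjugate values is 2i times
    the derivative of the argument. *)
Lemma Re_log_derivative_jump (c d c' d' : R) : c ^+ 2 + d ^+ 2 != 0 ->
  complex.Re ((0 +i* (2 * pi))^-1 *
    ((c' +i* d') / (c +i* d) - (c' -i* d') / (c -i* d))) =
  (c * d' - d * c') / (pi * (c ^+ 2 + d ^+ 2)) :> R.
Proof.
move=> n0; have pn : (pi : R) != 0 by rewrite gt_eqF// pi_gt0.
rewrite !complexV /= !(sqrrN d); move: (pi) pn => c0 pn; field.
by rewrite n0 pn.
Qed.

End HalfPlaneLimits.

(** * The density of mu_2^s *)

Section Density.
Variables (R : realType) (al q : R).
Hypotheses (al0 : 0 < al) (q0 : 0 <= q).
Variables (X r : R).
Hypotheses (X0 : 0 < X) (r1 : 1 < r).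

Notation b := (b_at R al q X r).
Notation Q := (big_abs R al q X r).
Notation xi0 := (pair_re R al q X r).
Notation k := (pair_disc R al q X r).
Notation P := (pair_norm2 R al q X r).
Notation eta0 := (pair_im R al q X r).

Definition realA (B z : R) : R :=
  z + (al + 2 * B + q) + B * (2 * al + B + q) / z + al * B ^+ 2 / z ^+ 2.

(** The root below -b, as a function of real y < 0; inverse to [realA]
    there; through it all roots are differentiated. *)
Definition large_root (B y : R) : R := - big_abs R al q (- y) (root_ratio R al q (- y) B).

Lemma large_rootK (B z : R) : 0 < B -> z < - B -> realA B z < 0 ->
  large_root B (realA B z) = z.
Proof.
move=> B0 zB Az; have zn : z + B < 0 by lra.
have [z0 zB0] : z != 0 /\ z + B != 0 by split; apply/negP => /eqP; lra.
set Y := - realA B z; have Y0 : 0 < Y by rewrite oppr_gt0.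
have s1 : 1 < z / (z + B).
  rewrite -subr_gt0; have -> : z / (z + B) - 1 = B / - (z + B).
    by field; rewrite ?oppr_eq0 ?z0 ?zB0.
  by rewrite divr_gt0// oppr_gt0.
have QE : big_abs R al q Y (z / (z + B)) = - z.
  by rewrite /big_abs /Y /realA; field; rewrite ?z0 ?zB0.
have BE : B = b_at R al q Y (z / (z + B)).
  by rewrite b_atE// QE; field; rewrite ?z0 ?zB0.
by rewrite /large_root -/Y [in root_ratio _ _ _ _ B]BE root_ratio_b_at// QE opprK.
Qed.

Lemma realA_large_root : realA b (- Q) = - X.
Proof.
have r0 : r != 0 by rewrite gt_eqF// (lt_trans _ r1).
have Q0 : Q != 0 by rewrite gt_eqF// (lt_trans al0)// big_abs_gt_al.
rewrite /realA b_atE//; move: Q0; rewrite /big_abs => Q0; field.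
by rewrite ?oppr_eq0 ?Q0 ?r0.
Qed.

Lemma is_derive_realA (B z : R) : z != 0 ->
  is_derive z 1 (realA B) (1 - B * (2 * al + B + q) / z ^+ 2
     - 2 * (al * B ^+ 2) / z ^+ 3).
Proof.
move=> z0.
have dV := is_derive_inv R z z0.
have -> : realA B = fun v : R => v + (al + 2 * B + q) +
    B * (2 * al + B + q) * v^-1 + al * B ^+ 2 * (v^-1 * v^-1).
  by apply/funext => v; rewrite /realA -invfM -expr2.
apply: is_derive_eq; rewrite /GRing.scale /=; field.
exact: z0.
Qed.

(** The squared distance between the large root and either member of the
    pair. *)
Definition gap_norm2 : R := Q ^+ 2 + 2 * xi0 * Q + P.

Hypothesis k0 : 0 < k.

Lemma gap_norm2_gt0 : 0 < gap_norm2.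
Proof.
have -> : gap_norm2 = (xi0 + Q) ^+ 2 + (r - 1) ^+ 2 * k.
  by rewrite /gap_norm2 -pair_norm2E//; ring.
by rewrite ltr_wpDl ?sqr_ge0// mulr_gt0// exprn_gt0// subr_gt0.
Qed.

(** Since A(z) - x has the three roots as its zeros, A' at the large root zeta
    is [gap_norm2]/zeta^2. *)
Lemma is_derive_large_root :
  is_derive (- X) 1 (large_root b) (gap_norm2 / Q ^+ 2)^-1.
Proof.
have Q0 : 0 < Q by rewrite (lt_trans al0)// big_abs_gt_al.
have Qb := big_abs_gt_b R al q al0 q0 X r X0 r1.
have b0 := b_at_gt0 R al q al0 q0 X r X0 r1.
have Qn : - Q != 0 by rewrite oppr_eq0 gt_eqF.
have dA := is_derive_realA b _ Qn.
have cA (z : R) : z != 0 -> {for z, continuous (realA b)}.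
  move=> z0.
  exact: (continuous_of_is_derive _ _ _ _ (is_derive_realA b _ z0)).
rewrite -[- X]realA_large_root.
apply: is_derive_inverse.
- near=> z; apply: large_rootK => //.
    by near: z; apply: lt_nbhsl; rewrite ltrN2.
  near: z; have := cA _ Qn; rewrite /prop_for /continuous_at realA_large_root => cAQ.
  by apply: (cvgr_lt _ cAQ); rewrite oppr_lt0.
- near=> z; apply: cA; apply: ltr0_neq0; near: z.
  by apply: lt_nbhsl; rewrite oppr_lt0.
- apply: is_derive_eq dA _.
  have e2 := root_pair_sumE R al q X r r1; have e3 := root_prodE R al q X r r1.
  rewrite -e2 -[al * _]opprK -e3 /gap_norm2; move: Qn.
  move: (xi0) (P) (Q) => u v w; rewrite oppr_eq0 => wn.
  by field; rewrite ?oppr_eq0 wn.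
- by rewrite mulf_neq0 ?invr_eq0 ?expf_neq0 ?gt_eqF// gap_norm2_gt0.
Unshelve. all: by end_near.
Qed.

End Density.

Section Density.
Variables (R : realType) (al q : R).
Hypotheses (al0 : 0 < al) (q0 : 0 <= q).

(** The density of mu_2^s at -X, where r is the ratio of the large root. *)
Definition mu2_rate (X r : R) : R :=
  (al / r ^+ 2 + (X * (r - 1) + q) / 2) /
  (2 * pi * Num.sqrt (pair_disc R al q X r) * (2 * X * r + q - X + al / r ^+ 2)).

(** The last factor is the derivative of [b_at] in r. *)
Lemma gap_norm2E (X r : R) : 1 < r -> gap_norm2 R al q X r =
  big_abs R al q X r * (2 * X * r + q - X + al / r ^+ 2).
Proof.
move=> r1; have rn : r != 0 by rewrite gt_eqF// (lt_trans _ r1).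
by rewrite /gap_norm2 /pair_re /pair_norm2 /big_abs; field.
Qed.

Lemma rate_numeratorE (X r : R) : 1 < r ->
  - (pair_re R al q X r * big_abs R al q X r + pair_norm2 R al q X r) =
  big_abs R al q X r * (r - 1) * (al / r ^+ 2 + (X * (r - 1) + q) / 2).
Proof.
move=> r1; have rn : r != 0 by rewrite gt_eqF// (lt_trans _ r1).
by rewrite /pair_re /pair_norm2 /big_abs; field.
Qed.

Section FixedB.
Variable b : R.
Hypothesis b0 : 0 < b.
Variables (z1 z2 z3 : R[i] -> R[i]).
Hypothesis sol : forall w, sorted_roots R al b q w (z1 w) (z2 w) (z3 w).

Let sqn (Z : R) := - (al * b ^+ 2) / Z.
Let re (Z : R) := (b * (2 * al + b + q) - sqn Z) / (2 * Z).
Let im (Z : R) := Num.sqrt (sqn Z - re Z ^+ 2).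
Let Zf := large_root R al q b.

(** For fixed b, Vieta's formulas give the pair in terms of the large root
    only. *)
Lemma pair_of_large_root (X r : R) : 0 < X -> 1 < r -> b_at R al q X r = b ->
  [/\ sqn (- big_abs R al q X r) = pair_norm2 R al q X r,
      re (- big_abs R al q X r) = pair_re R al q X r,
      sqn (- big_abs R al q X r) - re (- big_abs R al q X r) ^+ 2
        = (r - 1) ^+ 2 * pair_disc R al q X r
    & im (- big_abs R al q X r) = pair_im R al q X r].
Proof.
move=> X0 r1 bE.
have e2 := root_pair_sumE R al q X r r1; have e3 := root_prodE R al q X r r1.
rewrite bE in e2 e3.
have Q0 : 0 < big_abs R al q X r by rewrite (lt_trans al0)// big_abs_gt_al.
have Qn : - big_abs R al q X r != 0 by rewrite oppr_eq0 gt_eqF.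
have s : sqn (- big_abs R al q X r) = pair_norm2 R al q X r by rewrite /sqn -e3 mulfK.
have t : re (- big_abs R al q X r) = pair_re R al q X r.
  rewrite /re s -e2; move: Qn; move: (big_abs R al q X r) => v; rewrite oppr_eq0 => vn.
  by field.
have d : sqn (- big_abs R al q X r) - re (- big_abs R al q X r) ^+ 2
        = (r - 1) ^+ 2 * pair_disc R al q X r.
  by rewrite s t -pair_norm2E//; ring.
split=> //; rewrite /im d /pair_im sqrtrM ?sqr_ge0// sqrtr_sqr gtr0_norm//.
by rewrite subr_gt0.
Qed.

Lemma half_plane_limits (y : R) : y < 0 ->
  0 < sqn (Zf y) - re (Zf y) ^+ 2 ->
  upper_limit z2 y = re (Zf y) -i* im (Zf y) /\
  lower_limit z2 y = re (Zf y) +i* im (Zf y).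
Proof.
move=> y0 dpos.
have X0 : 0 < - y by rewrite oppr_gt0.
have [r1 bE] := root_ratioP R al q al0 q0 (- y) b X0 b0.
have [_ t d i] := pair_of_large_root _ _ X0 r1 bE.
have k0 : 0 < pair_disc R al q (- y) (root_ratio R al q (- y) b).
  move: dpos; rewrite /Zf /large_root d pmulr_rgt0//.
  by rewrite exprn_gt0// subr_gt0.
rewrite /Zf /large_root t i; split.
- apply: upper_limit_eq => e e0.
  have [dl dl0 H] := branch_limit R al q al0 q0 _ _ X0 r1 k0 e e0.
  exists dl => // w wp; rewrite -[y in y%:C]opprK => wd.
  have := H w (z1 w) (z2 w) (z3 w); rewrite bE => /(_ (sol w) wd) [h _].
  exact: h.
- apply: lower_limit_eq => e e0.
  have [dl dl0 H] := branch_limit R al q al0 q0 _ _ X0 r1 k0 e e0.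
  exists dl => // w wp; rewrite -[y in y%:C]opprK => wd.
  have := H w (z1 w) (z2 w) (z3 w); rewrite bE => /(_ (sol w) wd) [_ h].
  exact: h.
Qed.

(** Near -X the one-sided limits of z2 are explicit functions of the large root,
    which is differentiable; the derivative of the argument of the pair is then
    a rational expression in X, r and the square root of [pair_disc]. *)
Lemma mu2_density_rate (X : R) : 0 < X ->
  0 < pair_disc R al q X (root_ratio R al q X b) ->
  complex.Re (let z2p := upper_limit z2 in let z2m := lower_limit z2 in
    (0 +i* (2 * pi))^-1 * (cderive z2m (- X) / z2m (- X)
                           - cderive z2p (- X) / z2p (- X))) =
  mu2_rate X (root_ratio R al q X b).
Proof.
move=> X0 k0 /=.
have [r1 bE] := root_ratioP R al q al0 q0 X b X0 b0.
set r := root_ratio R al q X b in r1 bE k0 *.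
have [s t d i] := pair_of_large_root _ _ X0 r1 bE.
have Zx : Zf (- X) = - big_abs R al q X r by rewrite /Zf /large_root opprK.
have Q0 : 0 < big_abs R al q X r by rewrite (lt_trans al0)// big_abs_gt_al.
have dpos : 0 < sqn (Zf (- X)) - re (Zf (- X)) ^+ 2.
  by rewrite Zx d mulr_gt0// exprn_gt0// subr_gt0.
have dZ := is_derive_large_root R al q al0 q0 X r X0 r1 k0.
rewrite bE -/Zf in dZ.
set Z' := (X in is_derive _ _ _ X) in dZ.
have Zn : Zf (- X) != 0 by rewrite Zx oppr_eq0 gt_eqF.
have dV : is_derive (- X) 1 (fun y : R => (Zf y)^-1) (- Zf (- X) ^- 2 * Z').
  have := @is_deriveV R Zf (- X) Z' 1 Zn dZ.
  by move/is_derive_eq; apply; rewrite /GRing.scale/=.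
have ds : is_derive (- X) 1 (fun y => sqn (Zf y))
    ((al * b ^+ 2) / Zf (- X) ^+ 2 * Z').
  by rewrite /sqn; apply: is_derive_eq; rewrite /GRing.scale/=; ring.
have dre : is_derive (- X) 1 (fun y => re (Zf y))
    ((sqn (Zf (- X)) / (2 * Zf (- X) ^+ 2) - re (Zf (- X)) / Zf (- X)) * Z').
  have -> : (fun y => re (Zf y)) =
     fun y => 2^-1 * ((b * (2 * al + b + q) - sqn (Zf y)) * (Zf y)^-1).
    by apply/funext => y; rewrite /re invfM; ring.
  apply: is_derive_eq; rewrite /GRing.scale/= /re /sqn; field.
  exact: Zn.
set re' := (X in is_derive _ _ _ X) in dre.
set sq' := (X in is_derive _ _ _ X) in ds.
have dd : is_derive (- X) 1 (fun y => sqn (Zf y) - re (Zf y) ^+ 2)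
    (sq' - 2 * re (Zf (- X)) * re').
  by apply: is_derive_eq; rewrite /GRing.scale/=; ring.
have dim : is_derive (- X) 1 (fun y => im (Zf y))
    ((sq' - 2 * re (Zf (- X)) * re') / (2 * im (Zf (- X)))).
  have dsq := is_derive1_sqrt dpos.
  apply: (is_derive_eq (@is_derive1_comp R _ _ (- X) _ _ dsq dd)).
  by rewrite /GRing.scale /= /im mulrC.
set im' := (X in is_derive _ _ _ X) in dim.
have dimN : is_derive (- X) 1 (fun y => - im (Zf y)) (- im').
  by apply: is_derive_eq.
have nearX : \forall y \near - X,
    upper_limit z2 y = re (Zf y) -i* im (Zf y) /\
    lower_limit z2 y = re (Zf y) +i* im (Zf y).
  near=> y; apply: half_plane_limits; near: y.
    by apply: lt_nbhsl; rewrite oppr_lt0.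
  have cdd : {for (- X), continuous (fun y => sqn (Zf y) - re (Zf y) ^+ 2)}.
    exact: (continuous_of_is_derive _ _ _ _ dd).
  exact: (cvgr_gt _ cdd).
have [-> ->] := nbhs_singleton nearX.
have -> : cderive (lower_limit z2) (- X) = re' +i* im'.
  rewrite /cderive !derive1E.
  rewrite -(near_eq_derive (f := fun y => re (Zf y))); last first.
    by apply: filterS nearX => y [_ h] /=; rewrite h.
  rewrite -(near_eq_derive (f := fun y => im (Zf y))
    (g := fun y => complex.Im (lower_limit z2 y))); last first.
    by apply: filterS nearX => y [_ h] /=; rewrite h.
  by rewrite !derive_val.
have -> : cderive (upper_limit z2) (- X) = re' -i* im'.
  rewrite /cderive !derive1E.
  rewrite -(near_eq_derive (f := fun y => re (Zf y))); last first.
    by apply: filterS nearX => y [h _] /=; rewrite h.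
  rewrite -(near_eq_derive (f := fun y => - im (Zf y))
    (g := fun y => complex.Im (upper_limit z2 y))); last first.
    by apply: filterS nearX => y [h _] /=; rewrite h.
  by rewrite !derive_val.
have e3 := root_prodE R al q X r r1; rewrite bE in e3.
have etaP := pair_norm2_im R al q X r r1 (ltW k0).
have eta0 := pair_im_gt0 R al q X r r1 k0.
have P0 := pair_norm2_gt0 R al q al0 q0 X r X0 r1.
rewrite Re_log_derivative_jump; last by rewrite Zx t i etaP gt_eqF.
have B0 := gap_norm2_gt0 R al q X r r1 k0.
rewrite /im' /sq' /re' /Z' Zx s t i etaP.
rewrite (_ : al * b ^+ 2 = pair_norm2 R al q X r * big_abs R al q X r); last first.
  by rewrite -[LHS]opprK -e3; ring.
have N1 := gap_norm2E X r r1.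
have N2 := rate_numeratorE X r r1.
rewrite /mu2_rate.
set B := gap_norm2 R al q X r in B0 N1 *.
set n := al / r ^+ 2 + _ in N2 *.
set m := _ + al / r ^+ 2 in N1 *.
have {etaP} etaP : pair_im R al q X r ^+ 2 = pair_norm2 R al q X r - pair_re R al q X r ^+ 2.
  by rewrite -etaP; ring.
have m0 : m != 0.
  by apply/eqP => m0; move: B0; rewrite N1 m0 mulr0 ltxx.
have sk : pair_im R al q X r = (r - 1) * Num.sqrt (pair_disc R al q X r) by [].
have sk0 : Num.sqrt (pair_disc R al q X r) != 0 by rewrite gt_eqF// sqrtr_gt0.
have r10 : r - 1 != 0 by rewrite gt_eqF// subr_gt0.
have Qn : big_abs R al q X r != 0 by rewrite gt_eqF.
have Pn : pair_norm2 R al q X r != 0 by rewrite gt_eqF.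
have en : pair_im R al q X r != 0 by rewrite gt_eqF.
have pn : (pi : R) != 0 by rewrite gt_eqF// pi_gt0.
have Bn : B != 0 by rewrite gt_eqF.
transitivity (- (pair_re R al q X r * big_abs R al q X r + pair_norm2 R al q X r) /
    (2 * pi * pair_im R al q X r * B)).
  move: (pi) (pair_im R al q X r) (pair_norm2 R al q X r) (pair_re R al q X r) (big_abs R al q X r)
    etaP pn en Pn Qn => c0 y u v w yE cn yn un wn.
  have -> : forall A1 A2 : R, v * ((A1 - 2 * v * A2) / (2 * y)) - y * A2 =
      (v * A1 - 2 * (v ^+ 2 + y ^+ 2) * A2) / (2 * y).
    by move=> A1 A2; field.
  rewrite yE; field.
  by rewrite ?oppr_eq0 ?cn ?yn ?un ?wn ?Bn.
rewrite N2 N1 sk; move: (pi) (Num.sqrt _) pn sk0 => c0 y cn yn.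
by field; rewrite ?oppr_eq0 ?cn ?yn ?m0 ?Qn ?r10.
Unshelve. all: by end_near.
Qed.

End FixedB.
End Density.

(** * Integration of the density over s *)

Section IntegralRate.
Variables (R : realType) (al q : R).
Hypotheses (al0 : 0 < al) (q0 : 0 <= q).
Local Notation mu := (@lebesgue_measure R).
Variable X : R.
Hypothesis X0 : 0 < X.

Let slope (r : R) : R := 2 * X * r + q - X + al / r ^+ 2.

Lemma slope_gt0 (r : R) : 1 <= r -> 0 < slope r.
Proof.
move=> r1; have := q0; have : 0 < al / r ^+ 2 by rewrite divr_gt0// exprn_gt0//; lra.
have : X * 1 <= X * r by rewrite ler_pM2l.
have := X0; rewrite /slope; lra.
Qed.

Lemma mu2_rate_ge0 (r : R) : 1 <= r -> 0 <= mu2_rate R al q X r.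
Proof.
move=> r1; rewrite /mu2_rate divr_ge0//.
  rewrite addr_ge0 ?divr_ge0 ?sqr_ge0 ?(ltW al0)// addr_ge0//.
  by rewrite mulr_ge0 ?(ltW X0)// subr_ge0.
rewrite !mulr_ge0 ?pi_ge0 ?sqrtr_ge0//.
by apply/ltW/slope_gt0.
Qed.

Lemma pair_disc_lt (r r' : R) : 1 <= r -> r < r' -> pair_disc R al q X r' < pair_disc R al q X r.
Proof.
move=> r1 lt_rr'; have r0 : 0 < r by lra.
have r0' : 0 < r' by lra.
have h1 : al * X / r' < al * X / r.
  by rewrite ltr_pM2l ?mulr_gt0// ltf_pV2.
have h2 : (X * (r - 1) + q) ^+ 2 <= (X * (r' - 1) + q) ^+ 2.
  have e1 : 0 <= X * (r - 1) by rewrite mulr_ge0 ?subr_ge0// ltW.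
  have e2 : X * (r - 1) <= X * (r' - 1) by rewrite ler_pM2l//; lra.
  by have := q0 => q0'; rewrite ler_pXn2r// ?nnegrE; lra.
by rewrite /pair_disc; lra.
Qed.

Lemma pair_disc_root : 0 < pair_disc R al q X 1 -> exists2 r, 1 < r & pair_disc R al q X r = 0.
Proof.
move=> k1; pose P : {poly R} := (al * X)%:P - (4^-1) *: ('X * (X *: ('X - 1%:P) + q%:P) ^+ 2).
have PE y : P.[y] = al * X - 4^-1 * (y * (X * (y - 1) + q) ^+ 2).
  by rewrite /P !(hornerE, hornerXn, horner_exp)/=.
pose v := 1 + 4 * al / X.
have v1 : 1 < v by rewrite ltrDl divr_gt0// mulr_gt0.
have Xv : X * v = X + 4 * al by rewrite /v; field; rewrite gt_eqF.
have [||r] := @poly_ivt R (- P) 1 (1 + v).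
- by lra.
- rewrite !hornerN !PE oppr_le0 oppr_ge0; apply/andP; split.
    by move: k1; rewrite /pair_disc subrr mulr0 add0r divr1; lra.
  have h1 : 4 * al <= X * v + q by have := q0; have := X0; lra.
  have h2 : X <= X * v + q by have := q0; have := al0; lra.
  have h3 : 4 * al * X <= (X * v + q) ^+ 2.
    by rewrite expr2; apply: ler_pM => //; rewrite ?mulr_ge0// ltW.
  have h4 : 1 * (X * v + q) ^+ 2 <= (1 + v) * (X * v + q) ^+ 2.
    by rewrite ler_wpM2r ?sqr_ge0//; lra.
  rewrite (_ : 1 + v - 1 = v); last by ring.
  by lra.
move=> /andP[r1 r2] /rootP; rewrite hornerN PE => fr.
have {}r1 : 1 < r.
  rewrite lt_neqAle r1 andbT; apply/eqP => e; move: fr k1.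
  by rewrite -e /pair_disc subrr mulr0 add0r divr1; lra.
have rn : r != 0 by rewrite gt_eqF//; lra.
exists r => //; apply: (mulfI rn); rewrite mulr0.
have -> : r * pair_disc R al q X r = al * X - 4^-1 * (r * (X * (r - 1) + q) ^+ 2).
  by rewrite /pair_disc; field.
lra.
Qed.

Lemma is_derive_b_at (r : R) : r != 0 -> is_derive r 1 (b_at R al q X) (slope r).
Proof.
move=> r0.
have dV := is_derive_inv R r r0.
by rewrite /b_at; apply: is_derive_eq; rewrite /slope /GRing.scale /=; field.
Qed.

Lemma is_derive_root_ratio (r : R) : 1 < r ->
  is_derive (b_at R al q X r) 1 (root_ratio R al q X) (slope r)^-1.
Proof.
move=> r1; apply: is_derive_inverse.
- near=> z; apply: root_ratio_b_at => //; near: z; exact: lt_nbhsr.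
- near=> z; have z0 : z != 0.
    by rewrite gt_eqF//; near: z; apply: lt_nbhsr; lra.
  exact: (continuous_of_is_derive _ _ _ _ (is_derive_b_at z z0)).
- by apply: is_derive_b_at; rewrite gt_eqF//; lra.
- by rewrite gt_eqF// slope_gt0// ltW.
Unshelve. all: by end_near.
Qed.

(** As b tends to 0 the large root stays away from 0. *)
Lemma root_ratio_cvg1 (tau : R) : 0 < tau ->
  root_ratio R al q X (tau * s) @[s --> (0 : R)^'+] --> (1 : R).
Proof.
move=> tau0; apply/cvgrPdist_lt => e e0.
have p0 : 0 < b_at R al q X (1 + e) / tau.
  by apply: divr_gt0 => //; apply: b_at_gt0 => //; lra.
near=> s.
have s0 : 0 < s by near: s; exact: nbhs_right_gt.
have b0 : 0 < tau * s by rewrite mulr_gt0.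
have [r1 bE] := root_ratioP R al q al0 q0 X _ X0 b0.
have e1 : 1 < 1 + e by lra.
have : root_ratio R al q X (tau * s) < 1 + e.
  rewrite root_ratio_lt// mulrC -ltr_pdivlMr//.
by rewrite distrC gtr0_norm; lra.
Unshelve. all: by end_near.
Qed.

Lemma is_derive_pair_disc (r : R) : r != 0 -> is_derive r 1 (pair_disc R al q X)
  (- (X * (al / r ^+ 2 + (X * (r - 1) + q) / 2))).
Proof.
move=> r0.
have dV := is_derive_inv R r r0.
by rewrite /pair_disc; apply: is_derive_eq; rewrite /GRing.scale /=; field.
Qed.

Lemma continuous_mu2_rate (r : R) : 1 < r -> 0 < pair_disc R al q X r ->
  {for r, continuous (mu2_rate R al q X)}.
Proof.
move=> r1 k0; have r0 : r != 0 by rewrite gt_eqF//; lra.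
have cI : {for r, continuous (fun v : R => al / v ^+ 2)}.
  apply: cvgM; first exact: cvg_cst.
  by apply: cvgV; [rewrite expf_neq0|exact: exprn_continuous].
have cS : {for r, continuous slope}.
  apply: cvgD => //; apply: cvgB; last exact: cvg_cst.
  apply: cvgD; last exact: cvg_cst.
  by apply: cvgM; [exact: cvg_cst|exact: cvg_id].
have cN : {for r, continuous (fun v : R => al / v ^+ 2 + (X * (v - 1) + q) / 2)}.
  apply: cvgD => //; apply: cvgM; last exact: cvg_cst.
  apply: cvgD; last exact: cvg_cst.
  apply: cvgM; first exact: cvg_cst.
  by apply: cvgB; [exact: cvg_id|exact: cvg_cst].
have cK := continuous_of_is_derive _ _ _ _ (is_derive_pair_disc _ r0).
have cQ : {for r, continuous (fun v => Num.sqrt (pair_disc R al q X v))}.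
  by apply: (continuous_comp cK); exact: sqrt_continuous.
rewrite /mu2_rate; apply: cvgM => //; apply: cvgV.
  rewrite !mulf_neq0// ?gt_eqF ?pi_gt0 ?sqrtr_gt0//.
  by apply: slope_gt0; exact: ltW.
apply: cvgM => //; apply: cvgM => //; exact: cvg_cst.
Qed.

Variable tau : R.
Hypothesis tau0 : 0 < tau.

(** The rate is -1/(pi X) times the b-derivative of sqrt(pair_disc) at the ratio
    r(b).  This root decreases from its value at r = 1, for b = 0, to 0, where
    the pair becomes real. *)
Lemma integral_mu2_rate :
  (\int[mu]_s (if (0 < s) && (0 < pair_disc R al q X (root_ratio R al q X (tau * s)))
     then mu2_rate R al q X (root_ratio R al q X (tau * s)) else 0)%:E
   = (Num.sqrt (pair_disc R al q X 1) / (pi * X * tau))%:E)%E.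
Proof.
have b0 (s : R) : 0 < s -> 0 < tau * s by move=> s0; rewrite mulr_gt0.
have [k1|k1] := leP (pair_disc R al q X 1) 0.
  rewrite ler0_sqrtr// mul0r; apply: integral0_eq => s _.
  case: ifPn => // /andP[s0]; have [r1 _] := root_ratioP R al q al0 q0 X _ X0 (b0 _ s0).
  by have := pair_disc_lt 1 _ (lexx _) r1 => h1 h2; exfalso; lra.
have [rs rs1 krs] := pair_disc_root k1.
pose ss := b_at R al q X rs / tau.
have phis0 : 0 < b_at R al q X rs by exact: b_at_gt0.
have ss0 : 0 < ss by rewrite divr_gt0.
have zone (s : R) : 0 < s -> (0 < pair_disc R al q X (root_ratio R al q X (tau * s))) = (s < ss).
  move=> s0; have [r1 _] := root_ratioP R al q al0 q0 X _ X0 (b0 _ s0).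
  rewrite /ss ltr_pdivlMr// [s * _]mulrC -root_ratio_lt ?b0//.
  have [h|h|h] := ltrgtP (root_ratio R al q X (tau * s)) rs.
  - by rewrite -krs pair_disc_lt// ltW.
  - by rewrite ltNge -krs ltW// pair_disc_lt// ltW.
  - by rewrite h krs ltxx.
rewrite (integral_supported R `]0, ss[%classic
   (fun s => mu2_rate R al q X (root_ratio R al q X (tau * s)))); last 2 first.
- by move=> s; rewrite /= in_itv/= => /andP[s0 s1]; rewrite s0 zone// s1.
- move=> s; rewrite /= in_itv/= => h; case: ifPn => // /andP[s0].
  by rewrite zone// => s1; exfalso; apply: h; rewrite s0.
pose G (s : R) := - (Num.sqrt (pair_disc R al q X (root_ratio R al q X (tau * s))) / (pi * X * tau)).
have pn : (pi : R) != 0 by rewrite gt_eqF// pi_gt0.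
have Xn : X != 0 by rewrite gt_eqF.
have tn : tau != 0 by rewrite gt_eqF.
have drs (s : R) : 0 < s -> is_derive s 1 (fun s => root_ratio R al q X (tau * s))
    (tau / slope (root_ratio R al q X (tau * s))).
  move=> s0; have [r1 rE] := root_ratioP R al q al0 q0 X _ X0 (b0 _ s0).
  have d1 : is_derive s 1 (fun s : R => tau * s) tau.
    by apply: is_derive_eq; rewrite /GRing.scale/=; ring.
  have d2 := is_derive_root_ratio _ r1; rewrite rE in d2.
  by apply: (is_derive_eq (@is_derive1_comp R _ _ s _ _ d2 d1)); rewrite mulrC.
have dks (s : R) : 0 < s ->
    is_derive s 1 (fun s => pair_disc R al q X (root_ratio R al q X (tau * s)))
    (- (X * (al / root_ratio R al q X (tau * s) ^+ 2
       + (X * (root_ratio R al q X (tau * s) - 1) + q) / 2)) *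
       (tau / slope (root_ratio R al q X (tau * s)))).
  move=> s0; have [r1 rE] := root_ratioP R al q al0 q0 X _ X0 (b0 _ s0).
  have rn : root_ratio R al q X (tau * s) != 0 by rewrite gt_eqF//; lra.
  have d2 := is_derive_pair_disc _ rn.
  exact: (@is_derive1_comp R _ _ s _ _ d2 (drs s s0)).
have csq (s : R) : {for s, continuous (@Num.sqrt R)} by exact: sqrt_continuous.
have -> : Num.sqrt (pair_disc R al q X 1) / (pi * X * tau) =
   - (Num.sqrt 0 / (pi * X * tau)) - - (Num.sqrt (pair_disc R al q X 1) / (pi * X * tau)).
  by rewrite sqrtr0 mul0r oppr0 add0r opprK.
apply: (ge0_FTC2_oo R _ G) => //.
- move=> s /andP[s0 s1]; have [r1 rE] := root_ratioP R al q al0 q0 X _ X0 (b0 _ s0).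
  exact/mu2_rate_ge0/ltW.
- move=> s /andP[s0 s1]; have [r1 rE] := root_ratioP R al q al0 q0 X _ X0 (b0 _ s0).
  have crs := continuous_of_is_derive _ _ _ _ (drs s s0).
  have kpos : 0 < pair_disc R al q X (root_ratio R al q X (tau * s)) by rewrite zone.
  by apply: (continuous_comp crs); exact: continuous_mu2_rate.
- move=> s /andP[s0 s1]; have [r1 rE] := root_ratioP R al q al0 q0 X _ X0 (b0 _ s0).
  have kpos : 0 < pair_disc R al q X (root_ratio R al q X (tau * s)) by rewrite zone.
  have dsq := is_derive1_sqrt kpos.
  have dG := @is_derive1_comp R _ _ s _ _ dsq (dks s s0).
  have dG' : is_derive s 1 (fun s => Num.sqrt (pair_disc R al q X (root_ratio R al q X (tau * s)))) _ := dG.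
  rewrite /G; apply: is_derive_eq.
  have sn : slope (root_ratio R al q X (tau * s)) != 0.
    by rewrite gt_eqF// slope_gt0// ltW.
  have rn : root_ratio R al q X (tau * s) != 0 by rewrite gt_eqF//; lra.
  have kn : Num.sqrt (pair_disc R al q X (root_ratio R al q X (tau * s))) != 0.
    by rewrite gt_eqF// sqrtr_gt0.
  rewrite /GRing.scale /= /mu2_rate -/(slope _).
  move: sn kn; move: (slope _) (Num.sqrt _) (pi) pn => u v c0 pn sn kn.
  by field; rewrite ?pn ?kn ?tn ?Xn ?sn ?rn.
- apply: cvgN; apply: cvgM; last exact: cvg_cst.
  have r0 : (1 : R) != 0 by rewrite oner_eq0.
  have cK := continuous_of_is_derive _ _ _ _ (is_derive_pair_disc _ r0).
  have crs := root_ratio_cvg1 tau tau0.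
  have ckrs : pair_disc R al q X (root_ratio R al q X (tau * s)) @[s --> (0 : R)^'+]
      --> pair_disc R al q X 1.
    by apply: continuous_cvg => //; exact: cK.
  by apply: continuous_cvg => //; exact: csq.
- apply: cvg_at_left_filter; apply: cvgN; apply: cvgM; last exact: cvg_cst.
  have kss : pair_disc R al q X (root_ratio R al q X (tau * ss)) = 0.
    by rewrite /ss mulrC divfK// root_ratio_b_at.
  have cks := continuous_of_is_derive _ _ _ _ (dks ss ss0).
  have {}cks : pair_disc R al q X (root_ratio R al q X (tau * s)) @[s --> ss] --> (0 : R).
    by rewrite -kss; exact: cks.
  by apply: continuous_cvg => //; exact: csq.
Qed.

End IntegralRate.

(** * The measure sigma *)

Section JointDensity.
Variables (R : realType) (al q tau : R).
Hypotheses (al0 : 0 < al) (q0 : 0 <= q) (tau0 : 0 < tau).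
Local Notation mu := (@lebesgue_measure R).

(** Whatever its values at the two points, f is measurable because g is. *)
Lemma integral_eq_off2 (E : set R) (f g : R -> R) (c d : R) : measurable E ->
  measurable_fun [set: R] g ->
  (forall x, x != c -> x != d -> f x = g x) ->
  (\int[mu]_(x in E) (f x)%:E = \int[mu]_(x in E) (g x)%:E)%E.
Proof.
move=> mE mg fg.
have fE : f = fun x => if x == c then f c else if x == d then f d else g x.
  apply/funext => x; case: eqP => [->//|/eqP xc]; case: eqP => [->//|/eqP xd].
  exact: fg.
have mf : measurable_fun [set: R] f.
  rewrite fE; apply: measurable_fun_ifT => //; first exact: measurable_fun_eqr.
  by apply: measurable_fun_ifT => //; exact: measurable_fun_eqr.
apply: ae_eq_integral => //.
- by apply/measurable_EFinP; exact: measurable_funTS.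
- by apply/measurable_EFinP; exact: measurable_funTS.
exists ([set c] `|` [set d]); split.
- exact: measurableU.
- apply: countable_lebesgue_measure0; apply: finite_set_countable.
  by rewrite finite_setU; split; exact: finite_set1.
- move=> x /= nfg; apply: contrapT => /not_orP[/eqP xc /eqP xd]; apply: nfg => _.
  by rewrite fg.
Qed.

Let rho (sx : R * R) : R :=
  if (0 < sx.1) && (sx.2 < 0) then root_ratio R al q (- sx.2) (tau * sx.1) else 1.

(** The implicitly defined ratio has explicit superlevel sets, by monotonicity
    of [b_at]. *)
Lemma measurable_rho : measurable_fun [set: R * R] rho.
Proof.
have ms : measurable_fun [set: R * R] (fun sx : R * R => sx.1) by exact: measurable_fst.
have mx : measurable_fun [set: R * R] (fun sx : R * R => sx.2) by exact: measurable_snd.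
have mdom : measurable_fun [set: R * R] (fun sx => (0 < sx.1) && (sx.2 < 0)).
  by apply: measurable_and; apply: measurable_fun_ltr.
apply: (measurability _ (RGenCInfty.measurableE R)) => //.
move=> _ [_ [c ->] <-]; rewrite setTI.
have rho1 sx : 1 <= rho sx.
  rewrite /rho; case: ifPn => // /andP[s0 x0].
  have [r1 _] := root_ratioP R al q al0 q0 (- sx.2) (tau * sx.1)
    ltac:(by rewrite oppr_gt0) ltac:(by rewrite mulr_gt0).
  exact: ltW.
have [c1|c1] := leP c 1.
  rewrite (_ : _ @^-1` _ = setT); first exact: measurableT.
  by apply/seteqP; split => // sx _ /=; rewrite in_itv/= andbT (le_trans c1).
rewrite (_ : _ @^-1` _ = (fun sx : R * R => ((0 < sx.1) && (sx.2 < 0)) &&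
   (b_at R al q (- sx.2) c <= tau * sx.1)) @^-1` [set true]); last first.
  apply/seteqP; split => sx /=; rewrite in_itv/= andbT /rho.
    case: ifPn => [/andP[s0 x0]|_]; last by lra.
    by rewrite leNgt root_ratio_lt ?oppr_gt0 ?mulr_gt0// -leNgt.
  case: ifPn => [/andP[s0 x0]|//] /=.
  by rewrite leNgt -root_ratio_lt ?oppr_gt0 ?mulr_gt0// -leNgt.
rewrite -[X in measurable X]setTI.
apply: (measurable_and (f := fun sx : R * R => (0 < sx.1) && (sx.2 < 0))) => //.
apply: measurable_fun_ler; last exact: measurable_funM.
rewrite /b_at; apply: measurable_funM => //; apply: measurable_funD => //.
apply: measurable_funD => //; apply: measurable_funM => //.
exact: measurableT_comp.
Qed.

Definition joint_density (s x : R) : R :=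
  if (0 < s) && (x < 0) && (0 < pair_disc R al q (- x) (root_ratio R al q (- x) (tau * s)))
  then mu2_rate R al q (- x) (root_ratio R al q (- x) (tau * s)) else 0.

Lemma measurable_joint_density :
  measurable_fun [set: R * R] (fun sx => joint_density sx.1 sx.2).
Proof.
have ms : measurable_fun [set: R * R] (fun sx : R * R => sx.1) by exact: measurable_fst.
have mx : measurable_fun [set: R * R] (fun sx : R * R => sx.2) by exact: measurable_snd.
have mX : measurable_fun [set: R * R] (fun sx : R * R => - sx.2).
  exact: measurableT_comp.
have mr := measurable_rho.
have mdom : measurable_fun [set: R * R] (fun sx => (0 < sx.1) && (sx.2 < 0)).
  by apply: measurable_and; apply: measurable_fun_ltr.
have mri : measurable_fun [set: R * R] (fun sx => (rho sx)^-1).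
  exact: (measurableT_comp (measurable_invr R)).
have mr2i : measurable_fun [set: R * R] (fun sx => (rho sx ^+ 2)^-1).
  by apply: (measurableT_comp (measurable_invr R)); exact: measurable_funX.
have mXr : measurable_fun [set: R * R] (fun sx => - sx.2 * (rho sx - 1) + q).
  apply: measurable_funD => //; apply: measurable_funM => //.
  exact: measurable_funB.
have mk : measurable_fun [set: R * R] (fun sx => pair_disc R al q (- sx.2) (rho sx)).
  rewrite /pair_disc; apply: measurable_funB.
    by apply: measurable_funM => //; exact: measurable_funM.
  by apply: measurable_funM => //; exact: measurable_funX.
have mrate : measurable_fun [set: R * R] (fun sx => mu2_rate R al q (- sx.2) (rho sx)).
  rewrite /mu2_rate; apply: measurable_funM.
    by apply: measurable_funD; apply: measurable_funM.
  apply: (measurableT_comp (measurable_invr R)).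
  apply: measurable_funM.
    apply: measurable_funM => //.
    exact: (measurableT_comp (measurable_sqrtr R)).
  apply: measurable_funD; last exact: measurable_funM.
  apply: measurable_funB => //; apply: measurable_funD => //.
  by apply: measurable_funM => //; exact: measurable_funM.
rewrite (_ : (fun sx => _) = fun sx =>
    if ((0 < sx.1) && (sx.2 < 0)) && (0 < pair_disc R al q (- sx.2) (rho sx))
    then mu2_rate R al q (- sx.2) (rho sx) else 0); last first.
  apply/funext => sx; rewrite /joint_density /rho.
  by case: ((0 < sx.1) && (sx.2 < 0)).
apply: measurable_fun_ifT => //; apply: measurable_and => //.
exact: measurable_fun_ltr.
Qed.

Lemma joint_density_ge0 s x : 0 <= joint_density s x.
Proof.
rewrite /joint_density; case: ifPn => // /andP[/andP[s0 x0] _].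
have X0 : 0 < - x by rewrite oppr_gt0.
have [r1 _] := root_ratioP R al q al0 q0 _ _ X0 (mulr_gt0 tau0 s0).
by apply: mu2_rate_ge0 => //; exact: ltW.
Qed.

Lemma integral_joint_density x :
  (\int[mu]_s (joint_density s x)%:E =
   (if x < 0 then Num.sqrt (pair_disc R al q (- x) 1) / (pi * - x * tau) else 0)%:E)%E.
Proof.
case: ifPn => x0; last first.
  by apply: integral0_eq => s _; rewrite /joint_density (negbTE x0) andbF.
rewrite -(integral_mu2_rate R al q al0 q0)// ?oppr_gt0//.
by apply: eq_integral => s _; rewrite /joint_density x0 andbT.
Qed.

End JointDensity.

Section Sigma.
Variables (R : realType) (al q tau : R).
Hypotheses (al0 : 0 < al) (q0 : 0 <= q) (tau0 : 0 < tau).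
Local Notation mu := (@lebesgue_measure R).
Variables z1 z2 z3 : R[i] -> R -> R[i].
Hypothesis sol : forall (w : R[i]) (s : R), 0 < s ->
  sorted_roots R al (tau * s) q w (z1 w s) (z2 w s) (z3 w s).

(** Gamma_2 and the set where [pair_disc] is positive differ at most by the
    point 0 and the unique x where the pair is a double root. *)
Lemma mu2_joint_density (s : R) (E : set R) : measurable E -> 0 < s ->
  (mu2 z2 z3 s E = \int[mu]_(x in E) (joint_density R al q tau s x)%:E)%E.
Proof.
move=> mE s0; have b0 : 0 < tau * s by rewrite mulr_gt0.
have [c hc] : exists c : R, forall x : R, x < 0 ->
    pair_disc R al q (- x) (root_ratio R al q (- x) (tau * s)) = 0 -> x = c.
  have [[c [c0 kc]]|h] := pselect (exists c : R, c < 0 /\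
      pair_disc R al q (- c) (root_ratio R al q (- c) (tau * s)) = 0); last first.
    by exists 0 => x x0 kx; exfalso; apply: h; exists x.
  exists c => x x0 kx; apply: oppr_inj.
  have X0 : 0 < - x by rewrite oppr_gt0.
  have C0 : 0 < - c by rewrite oppr_gt0.
  have [r1 rE] := root_ratioP R al q al0 q0 _ _ X0 b0.
  have [r1' rE'] := root_ratioP R al q al0 q0 _ _ C0 b0.
  apply: (double_root_unique R al q al0 q0 _ _ _ _ X0 C0 r1 r1' _ kx kc).
  by rewrite rE rE'.
rewrite /mu2 integral_mkcondr.
pose f (x : R) : R := if `[< Gamma2 z2 z3 s x%:C >] then complex.Re (mu2_density z2 s x) else 0.
transitivity (\int[mu]_(x in E) (f x)%:E)%E.
  apply: eq_integral => x _; rewrite patchE /f.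
  by case: asboolP => h; [rewrite mem_set|rewrite memNset].
apply: (integral_eq_off2 R _ _ _ 0 c) => //.
  have -> : joint_density R al q tau s =
      (fun sx => joint_density R al q tau sx.1 sx.2) \o (pair s) by [].
  apply: measurableT_comp; first exact: measurable_joint_density.
  exact: measurable_pair1.
move=> x x0 xc; rewrite /f /joint_density s0 /=.
have [xp|xn|xe] := ltrgtP x 0; last by rewrite xe eqxx in x0.
- have X0 : 0 < - x by rewrite oppr_gt0.
  have [r1 rE] := root_ratioP R al q al0 q0 _ _ X0 b0.
  have S : sorted_roots R al (b_at R al q (- x) (root_ratio R al q (- x) (tau * s))) q
      (- - x)%:C (z1 x%:C s) (z2 x%:C s) (z3 x%:C s).
    by rewrite rE opprK; exact: sol.
  have [k0|k0|k0] := ltrgtP 0 (pair_disc R al q (- x) (root_ratio R al q (- x) (tau * s))).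
  + rewrite ifT; last first.
      apply/asboolP; rewrite /Gamma2 /=.
      exact: (negative_x_moduli R al q al0 q0 _ _ X0 r1 _ _ _ (ltW k0) S).
    have := mu2_density_rate R al q al0 q0 (tau * s) b0 (z1 ^~ s) (z2 ^~ s)
      (z3 ^~ s) (fun w => sol w s s0) (- x) X0 k0.
    by rewrite /mu2_density opprK => <-.
  + rewrite ifF//; apply/asboolP; rewrite /Gamma2 /= => e.
    have := negative_x_moduli_lt R al q al0 q0 _ _ X0 r1 _ _ _ k0 S.
    by rewrite e ltxx.
  + by move/eqP: xc; case; apply: hc.
- rewrite ifF//; apply/asboolP; rewrite /Gamma2 /= => e.
  have [_ h _] := positive_window R al _ q x al0 b0 q0 xn _ _ _ (sol x%:C s s0).
  by rewrite e ltxx in h.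
Qed.

Lemma sigma_joint_density (E : set R) : measurable E ->
  (sigma z2 z3 E = \int[mu]_(x in E)
     (if x < 0 then Num.sqrt (pair_disc R al q (- x) 1) / (pi * - x * tau) else 0)%:E)%E.
Proof.
move=> mE; rewrite /sigma.
pose F (s x : R) : R := joint_density R al q tau s x * \1_E x.
have mF : measurable_fun [set: R * R] (fun sx => F sx.1 sx.2).
  apply: measurable_funM; first exact: measurable_joint_density.
  by apply: (measurableT_comp (measurable_indic mE)); exact: measurable_snd.
have F0 s x : 0 <= F s x by rewrite mulr_ge0// joint_density_ge0.
have FE (h : R -> R) : (\int[mu]_(x in E) (h x)%:E = \int[mu]_x (h x * \1_E x)%:E)%E.
  rewrite integral_mkcond; apply: eq_integral => x _.
  by rewrite patchE indicE; case: ifPn; rewrite ?mulr1 ?mulr0.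
transitivity (\int[mu]_s \int[mu]_x (F s x)%:E)%E.
  rewrite integral_mkcond; apply: eq_integral => s _.
  rewrite patchE; case: ifPn => [|/negP]; rewrite inE /= in_itv/= andbT => s0.
    by rewrite mu2_joint_density// FE.
  rewrite integral0_eq// => x _; rewrite /F /joint_density.
  by move/negP/negbTE: s0 => ->; rewrite /= mul0r.
transitivity (\int[mu]_x \int[mu]_s (F s x)%:E)%E.
  apply: (fubini_tonelli (m1 := mu) (m2 := mu) (fun sx => (F sx.1 sx.2)%:E)).
    by apply/measurable_EFinP.
  by move=> sx; rewrite lee_fin.
rewrite [RHS]FE; apply: eq_integral => x _; rewrite /F indicE.
case: (x \in E); rewrite /= ?mulr1 ?mulr0; last first.
  by apply: integral0_eq => s _; rewrite mulr0.
under eq_integral do rewrite mulr1.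
exact: integral_joint_density.
Qed.

End Sigma.

Theorem theorem1p8 (R : realType) (a t : R) (ha : 0 < a) (ht0 : 0 < t)
    (ht1 : t < 1) (p : R) (hp : 0 <= p)
    (z1 z2 z3 : R[i] -> R -> R[i])
    (hz : labelled_solutions a t p z1 z2 z3) :
  (forall x : R, 0 < x ->
     V z1 z2 x =
       (x / (t * (1 - t))
        - Num.sqrt (p ^+ 2 * t ^+ 2 + 4 * a * x) / t
        - p * ln (Num.sqrt (p ^+ 2 * t ^+ 2 + 4 * a * x) - p * t)
        + a * (1 - t) / t
        + p * ln (2 * a * (1 - t)))%:E)
  /\
  (forall E : set R, measurable E ->
     sigma z2 z3 E =
       (\int[lebesgue_measure]_(x in E `&` `]-oo, 0%R]%classic)
          (sigma_density a t p x)%:E)%E).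
Proof.
have t1 : 0 < 1 - t by lra.
set al := a * (1 - t) ^+ 2; set q := p * t * (1 - t); set tau := t * (1 - t).
have al0 : 0 < al by rewrite mulr_gt0// exprn_gt0.
have q0 : 0 <= q by rewrite !mulr_ge0// ltW.
have tau0 : 0 < tau by rewrite mulr_gt0.
have sol (w : R[i]) (s : R) : 0 < s ->
    sorted_roots R al (tau * s) q w (z1 w s) (z2 w s) (z3 w s).
  by move=> s0; apply: ordered_solutions_sorted_roots; exact: hz.
have an : a != 0 by rewrite gt_eqF.
have tn : t != 0 by rewrite gt_eqF.
have t1n : 1 - t != 0 by rewrite gt_eqF.
split.
- move=> x x0.
  rewrite /V (integral_log_ratio R al q x al0 q0 x0 tau tau0 (z1 x%:C) (z2 x%:C) (z3 x%:C)); last first.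
    by move=> s s0; exact: sol.
  congr _%:E; set S := Num.sqrt (p ^+ 2 * t ^+ 2 + 4 * a * x).
  have SE : Num.sqrt (q ^+ 2 + 4 * al * x) = (1 - t) * S.
    have -> : q ^+ 2 + 4 * al * x = (1 - t) ^+ 2 * (p ^+ 2 * t ^+ 2 + 4 * a * x).
      by rewrite /q /al; ring.
    by rewrite sqrtrM ?sqr_ge0// sqrtr_sqr gtr0_norm.
  have u0 := up_gt0 R al q x al0 q0 x0; have uE := up_root R al q x al0 x0.
  rewrite SE in u0 uE *.
  have upE : ((1 - t) * S - q) / (2 * al) = (S - p * t) / (2 * a * (1 - t)).
    by rewrite /q /al; field; rewrite t1n.
  rewrite upE in u0 uE *.
  have S0 : 0 < S - p * t.
    by move: u0; rewrite pmulr_lgt0// invr_gt0 !mulr_gt0.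
  rewrite ln_div ?posrE ?mulr_gt0// ln1.
  set u := (S - p * t) / (2 * a * (1 - t)) in u0 uE *.
  have un : u != 0 by rewrite gt_eqF.
  have xu : x / u = al * u + q by rewrite -uE; field.
  rewrite xu /u /al /q /tau; field.
  by rewrite t1n tn an.
- move=> E mE; rewrite (sigma_joint_density R al q tau al0 q0 tau0 z1 z2 z3 sol)//.
  rewrite integral_mkcondr; apply: eq_integral => x _; rewrite patchE.
  have a4 : 0 < 4 * a by rewrite mulr_gt0.
  have pt0 : 0 <= p ^+ 2 * t ^+ 2 / (4 * a).
    by rewrite divr_ge0 ?mulr_ge0 ?sqr_ge0// ltW.
  have pn : (pi : R) != 0 by rewrite gt_eqF// pi_gt0.
  have [x0|x0] := ltP x 0; last first.
    case: ifPn => [|//]; rewrite inE /= in_itv /= => x0'.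
    have -> : x = 0 by apply/eqP; rewrite eq_le x0'.
    by rewrite /sigma_density normr0 !mulr0 invr0 mulr0 if_same.
  rewrite mem_set/=; last by rewrite in_itv/= ltW.
  congr _%:E; rewrite /sigma_density ltr0_norm//.
  have kE : pair_disc R al q (- x) 1 =
      ((1 - t) / 2) ^+ 2 * (4 * a * - x - p ^+ 2 * t ^+ 2).
    by rewrite /pair_disc /al /q subrr mulr0 add0r divr1; field.
  have t2 : 0 <= (1 - t) / 2 by rewrite divr_ge0// ltW.
  rewrite kE sqrtrM ?sqr_ge0// sqrtr_sqr ger0_norm//.
  case: ifPn => xp.
    have xn : x != 0 by rewrite lt_eqF.
    rewrite /tau; move: (pi) pn => c0 pn; field.
    by rewrite xn pn tn t1n.
  rewrite ler0_sqrtr ?mulr0 ?mul0r//.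
  move: xp; rewrite -ltNge ltrNl ltr_pdivlMr//; lra.
Qed.
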